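(* Let $n\ge2$ and let $f_1,\dots,f_n:\mathbb{R}^d\to\mathbb{R}$ be convex, twice differentiable and $L$-smooth, with Hessians $H_i$ satisfying $\|H_i(x)-H_i(y)\|\le L_H\|x-y\|$ for all $x,y$. Let $F=\frac1n\sum_{i=1}^nf_i$ (not assumed strongly convex), let $x^*$ be an arbitrary minimizer of $F$, and let $$\Delta=\mathbb{E}_{i\ne j}\big[H_i(x^* )\nabla f_j(x^* )\big],$$ with $(i,j)$ uniform over ordered pairs of distinct indices in $\{1,\dots,n\}$. Let $\delta$ satisfy $\|\nabla F(x)-\nabla f_i(x)\|\le\delta$ for all $i$ and all $x$, and assume the boundedness assumptions with constants $D,G$ stated in the context. Let $T$ be a positive multiple of $n$, and run RandomShuffle on $F$ for $T$ iterations with constant step size $$\gamma=\min\left\{\frac1{16nL},\ \sqrt{\frac{D}{Tn\left(\|\Delta\|+L_HLD^2+2L_HDG\right)}},\ \Big(\frac{D}{Tn^2L^2\delta}\Big)^{1/3},\ \Big(\frac1{Tn^3L^4}\Big)^{1/4}\right\}.$$ Let $\bar x=\frac nT\sum_{i=1}^{T/n}x^i_0$. Then $$\mathbb{E}[F(\bar x)]-F(x^* )\le\frac{2D\sqrt{nD\left(\|\Delta\|+L_HLD^2+2L_HDG\right)}}{\sqrt T}+\mathcal{O}\left(\Big(\frac nT\Big)^{2/3}\delta^{1/3}+\Big(\frac nT\Big)^{3/4}\right),$$ where the $\mathcal{O}$ term is bounded by $C_0(1+\log T)^q\big((n/T)^{2/3}\delta^{1/3}+(n/T)^{3/4}\big)$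 for constants $C_0,q>0$ depending only on $L,L_H,D,G$.
   Context: Norms are Euclidean for vectors and spectral for matrices. $f$ is $L$-smooth ($L>0$) if $\|\nabla f(x)-\nabla f(y)\|\le L\|x-y\|$ for all $x,y$. Terms in the minimum defining $\gamma$ with zero denominator are interpreted as $+\infty$. One may take $\delta\le2G$. RandomShuffle with step size $\gamma$, run for $T=ln$ iterations ($l$ a positive integer, the number of epochs) from $x_0\in\mathbb{R}^d$: set $x^1_0=x_0$. In each epoch $t=1,\dots,l$ draw a permutation $\sigma_t$ of $\{1,\dots,n\}$ uniformly at random, independently across epochs, and for $k=1,\dots,n$ set $x^t_k=x^t_{k-1}-\gamma\nabla f_{\sigma_t(k)}(x^t_{k-1})$; then put $x^{t+1}_0=x^t_n$. Thus $x^t_0$ is the point at the boundary between epochs $t-1$ and $t$. Expectation is over the permutations. Boundedness assumptions: there are constants $D,G>0$ with $\delta\le 2G$ such that, for every realization of the permutations, every iterate $x$ satisfies $\|x-x^*\|\le D$; and $\|\nabla f_i(x)\|\le G$ for all $i$ and all $x$ with $\|x-x^*\|\le D$. Convention: $\mathcal{O}(\cdot)$ hides logarithmic factors and constants depending only on the problem constants, not on $n$ or $T$. *)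

(* Defs.v *)
From HB Require Import structures.
From mathcomp Require Import all_boot all_order all_algebra all_fingroup.
From mathcomp Require Import all_classical all_reals all_analysis.
Set Implicit Arguments.
Unset Strict Implicit.
Unset Printing Implicit Defensive.
Import Order.TTheory GRing.Theory Num.Theory.
Import numFieldNormedType.Exports.
Local Open Scope classical_set_scope.
Local Open Scope ring_scope.

(* Points of R^d are row vectors 'rV[R]_d. The norm `|x| that
   the library puts on 'rV[R]_d is the sup norm; it is used here only through
   [differentiable] and ['J], which do not depend on the choice of a norm. *)

Definition enorm (R : realType) (d : nat) (v : 'rV[R]_d) : R :=
  Num.sqrt (\sum_(i < d) v 0 i ^+ 2).

(* The set is nonempty (v = 0) and bounded above, so [sup] is its supremum. *)
Definition spectral_norm (R : realType) (d : nat) (A : 'M[R]_d) : R :=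
  sup [set enorm (v *m A) | v in [set v : 'rV[R]_d | enorm v <= 1]].

Definition grad (R : realType) (d : nat) (f : 'rV[R]_d -> R) (x : 'rV[R]_d) :
    'rV[R]_d :=
  \row_(i < d) 'D_(delta_mx 0 i) f x.

(* Because vectors are rows and ['J] acts on the right, the product of the
   Hessian at x with the vector v is [v *m hess f x]. *)
Definition hess (R : realType) (d : nat) (f : 'rV[R]_d -> R) (x : 'rV[R]_d) :
    'M[R]_d :=
  'J (grad f) x.

Definition twice_differentiable (R : realType) (d : nat) (f : 'rV[R]_d -> R) :
    Prop :=
  (forall x, differentiable f x) /\ (forall x, differentiable (grad f) x).

Definition smooth (R : realType) (d : nat) (L : R) (f : 'rV[R]_d -> R) : Prop :=
  forall x y, enorm (grad f x - grad f y) <= L * enorm (x - y).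

Definition lipschitz_hess (R : realType) (d : nat) (LH : R)
    (f : 'rV[R]_d -> R) : Prop :=
  forall x y, spectral_norm (hess f x - hess f y) <= LH * enorm (x - y).

Definition average (R : realType) (d n : nat) (f : 'I_n -> 'rV[R]_d -> R)
    (x : 'rV[R]_d) : R :=
  n%:R^-1 * \sum_(i < n) f i x.

Definition Delta (R : realType) (d n : nat) (f : 'I_n -> 'rV[R]_d -> R)
    (xstar : 'rV[R]_d) : 'rV[R]_d :=
  let pairs := [set p : 'I_n * 'I_n | p.1 != p.2]%SET in
  #|pairs|%:R^-1 *:
    \sum_(p in pairs) grad (f p.2) xstar *m hess (f p.1) xstar.

(* Division is that of \bar R, where x / 0 = +oo for x > 0. The argument B
   stands for ||Delta|| + LH L D^2 + 2 LH D G. The first term of the minimum is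
   finite when 0 < n and 0 < L, hence so is the minimum. *)
Definition step_size (R : realType) (n T : nat) (L D delta B : R) : R :=
  fine (Order.min ((1%:E / (16 * n%:R * L)%:E)%E)
       (Order.min (sqrte (D%:E / (T%:R * n%:R * B)%:E)%E)
       (Order.min
          (poweR (D%:E / (T%:R * n%:R ^+ 2 * L ^+ 2 * delta)%:E)%E (1 / 3))
          (poweR (1%:E / (T%:R * n%:R ^+ 3 * L ^+ 4)%:E)%E (1 / 4))))).

(* The point reached from x after the first k steps of an epoch that uses the
   permutation s; [enum 'I_n] lists 0, ..., n - 1 in increasing order. *)
Definition epoch_iterate (R : realType) (d n : nat) (f : 'I_n -> 'rV[R]_d -> R)
    (gamma : R) (s : 'S_n) (k : nat) (x : 'rV[R]_d) : 'rV[R]_d :=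
  foldl (fun y j => y - gamma *: grad (f (s j)) y) x (take k (enum 'I_n)).

(* Epochs are numbered from 0: [boundary f gamma sigma x0 t] is the point
   x^(t+1)_0 at the start of epoch t + 1, in particular it is x0 for t = 0. *)
Definition boundary (R : realType) (d n l : nat) (f : 'I_n -> 'rV[R]_d -> R)
    (gamma : R) (sigma : {ffun 'I_l -> 'S_n}) (x0 : 'rV[R]_d) (t : nat) :
    'rV[R]_d :=
  foldl (fun y u => epoch_iterate f gamma (sigma u) n y) x0 (take t (enum 'I_l)).

Definition iterate (R : realType) (d n l : nat) (f : 'I_n -> 'rV[R]_d -> R)
    (gamma : R) (sigma : {ffun 'I_l -> 'S_n}) (x0 : 'rV[R]_d)
    (t : 'I_l) (k : nat) : 'rV[R]_d :=
  epoch_iterate f gamma (sigma t) k (boundary f gamma sigma x0 t).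

Definition xbar (R : realType) (d n l : nat) (f : 'I_n -> 'rV[R]_d -> R)
    (gamma : R) (x0 : 'rV[R]_d) (sigma : {ffun 'I_l -> 'S_n}) : 'rV[R]_d :=
  l%:R^-1 *: \sum_(t < l) iterate f gamma sigma x0 t 0.

(* Expectation over l independent uniform permutations: the family sigma is
   uniform on the finite set of all families. *)
Definition expect (R : realType) (n l : nat) (X : {ffun 'I_l -> 'S_n} -> R) : R :=
  #|{ffun 'I_l -> 'S_n}|%:R^-1 * \sum_(sigma : {ffun 'I_l -> 'S_n}) X sigma.

(* Main.v *)
Require Import Defs.
From HB Require Import structures.
From mathcomp Require Import all_boot all_order all_algebra all_fingroup.
From mathcomp Require Import all_classical all_reals all_analysis.
From mathcomp Require Import ring lra.
Import Order.TTheory GRing.Theory Num.Theory.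
Import numFieldNormedType.Exports.
Set Implicit Arguments.
Unset Strict Implicit.
Unset Printing Implicit Defensive.
Local Open Scope classical_set_scope.
Local Open Scope ring_scope.

(** Let [x] be the point at the start of an epoch, [w] its difference with the
    minimizer, [N] the gradient of the average at [x], and [z = gamma n] the total
    step of the epoch. The epoch moves [x] by [- gamma (n N + r)], where [r] adds
    up the changes of the component gradients between [x] and the points where
    they are evaluated, so that the squared distance to the minimizer becomes

      |w|^2 - 2 z <w, N> - 2 gamma <w, r> + gamma^2 |n N + r|^2.

    By convexity [<w, N>] is at least the optimality gap, and [|N|^2] is at most
    [4 L] times the gap; as [16 z L <= 1], errors of order [z^2 |N|^2] are
    absorbed in the gap.

    The term [<w, r>] decides the rate. To first order in [gamma], [r] is
    [- gamma] times the sum of [a_(s j) H_(s k)] over [j < k], where [a_i] and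
    [H_i] are the component gradients and Hessians at [x] and [s] is the order of
    the epoch (grad_drift_second_order). For an order and its reversal, these sums
    add up to the sum of [a_p H_q] over all pairs of distinct indices
    (second_order_rev). As the law of a uniform permutation is invariant under
    reversal, averaging over these two orders is enough. The sum over pairs is
    compared with its value at the minimizer, which is governed by [Delta]; here
    the symmetry of the Hessians and a sign make the two largest errors harmless
    (pair_sum_le). This gives the error [z^2 D B], where [B] is the bracket in the
    step size. All other errors come from the drift inside the epoch, which is at
    most [2 z (delta + |N|)] (epoch_drift); they are either absorbed in the gap or
    bounded by [z^3 delta] and by [z / l], where [l] is the number of epochs
    (epoch_budget).

    Telescoping over the epochs and convexity bound the expected gap at the mean
    point by

      D^2 / (z l) + z D B + K1 z^2 delta + K2 / l.

    The minimum that defines [gamma] bounds the last three summands, and the term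
    that attains it gives the value of the first one. When this is the second
    term, the first two summands are equal and add up to the leading term of the
    rate; everything else is in the remainder, without logarithms (rate_bound). *)

(** * The Euclidean inner product and norm *)

Section Euclidean.
Variables (R : realType) (d : nat).
Implicit Types (u v w : 'rV[R]_d) (A : 'M[R]_d).

Definition dot u v : R := \sum_(i < d) u 0 i * v 0 i.

Lemma dotC u v : dot u v = dot v u.
Proof. by apply: eq_bigr => i _; rewrite mulrC. Qed.

Lemma dotDl u v w : dot (u + v) w = dot u w + dot v w.
Proof. by rewrite -big_split; apply: eq_bigr => i _; rewrite mxE mulrDl. Qed.

Lemma dotZl (a : R) u v : dot (a *: u) v = a * dot u v.
Proof. by rewrite mulr_sumr; apply: eq_bigr => i _; rewrite mxE mulrA. Qed.

Lemma dotDr u v w : dot u (v + w) = dot u v + dot u w.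
Proof. by rewrite dotC dotDl !(dotC u). Qed.

Lemma dotZr (a : R) u v : dot u (a *: v) = a * dot u v.
Proof. by rewrite dotC dotZl (dotC u). Qed.

Lemma dotNl u v : dot (- u) v = - dot u v.
Proof. by rewrite -scaleN1r dotZl mulN1r. Qed.

Lemma dotNr u v : dot u (- v) = - dot u v.
Proof. by rewrite dotC dotNl dotC. Qed.

Lemma dotBl u v w : dot (u - v) w = dot u w - dot v w.
Proof. by rewrite dotDl dotNl. Qed.

Lemma dotBr u v w : dot u (v - w) = dot u v - dot u w.
Proof. by rewrite dotDr dotNr. Qed.

Lemma dot0l u : dot 0 u = 0.
Proof. by rewrite -(scale0r 0) dotZl mul0r. Qed.

Lemma dot_sumr I (r : seq I) (P : pred I) u (F : I -> 'rV[R]_d) :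
  dot u (\sum_(i <- r | P i) F i) = \sum_(i <- r | P i) dot u (F i).
Proof.
by apply: (big_morph (dot u)) => [v w|]; rewrite ?dotDr// dotC dot0l.
Qed.

Lemma dot_ge0 u : 0 <= dot u u.
Proof. by apply: sumr_ge0 => i _; rewrite -expr2 sqr_ge0. Qed.

Lemma enormE u : enorm u = Num.sqrt (dot u u).
Proof. by congr Num.sqrt; apply: eq_bigr => i _; rewrite expr2. Qed.

Lemma enorm_ge0 u : 0 <= enorm u.
Proof. exact: sqrtr_ge0. Qed.

Lemma sqr_enorm u : enorm u ^+ 2 = dot u u.
Proof. by rewrite enormE sqr_sqrtr// dot_ge0. Qed.

Lemma enorm0 : enorm (0 : 'rV[R]_d) = 0.
Proof. by rewrite enormE dot0l sqrtr0. Qed.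

Lemma enorm0_eq0 u : enorm u = 0 -> u = 0.
Proof.
move=> u0; have : dot u u == 0 by rewrite -sqr_enorm u0 expr0n.
rewrite psumr_eq0 => [/allP u0P|i _]; last by rewrite -expr2 sqr_ge0.
apply/rowP => i; rewrite mxE; apply/eqP.
by have := u0P i (mem_index_enum _); rewrite mulf_eq0 orbb.
Qed.

Lemma enormZ (a : R) u : enorm (a *: u) = `|a| * enorm u.
Proof.
by rewrite !enormE dotZl dotZr mulrA -expr2 sqrtrM ?sqr_ge0// sqrtr_sqr.
Qed.

Lemma enormN u : enorm (- u) = enorm u.
Proof. by rewrite -scaleN1r enormZ normrN normr1 mul1r. Qed.

Lemma enormB u v : enorm (u - v) = enorm (v - u).
Proof. by rewrite -enormN opprB. Qed.

Lemma dot_le_enorm u v : dot u v <= enorm u * enorm v.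
Proof.
have [v0|v0] := eqVneq (enorm v) 0.
  by rewrite v0 (enorm0_eq0 v0) dotC dot0l mulr0.
have v_gt0 : 0 < enorm v by rewrite lt0r v0 enorm_ge0.
have := dot_ge0 (enorm v *: u - enorm u *: v).
rewrite !(dotBl, dotBr, dotZl, dotZr) -!sqr_enorm (dotC v u).
have [u0|u0] := eqVneq (enorm u) 0.
  by move=> _; rewrite (enorm0_eq0 u0) dot0l enorm0 mul0r.
have u_gt0 : 0 < enorm u by rewrite lt0r u0 enorm_ge0.
set a := enorm u; set b := enorm v; set c := dot u v => abc.
have : 0 <= (a * b) * (a * b - c) by nra.
by rewrite pmulr_rge0 ?mulr_gt0// subr_ge0.
Qed.

Lemma norm_dot_le u v : `|dot u v| <= enorm u * enorm v.
Proof.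
rewrite ler_norml dot_le_enorm andbT lerNl -dotNl.
by rewrite (le_trans (dot_le_enorm _ _))// enormN.
Qed.

Lemma enormD u v : enorm (u + v) <= enorm u + enorm v.
Proof.
rewrite -(ler_pXn2r (n := 2))// ?nnegrE ?addr_ge0 ?enorm_ge0//.
rewrite sqr_enorm !(dotDl, dotDr) -!sqr_enorm (dotC v u).
have := dot_le_enorm u v; nra.
Qed.

Lemma enorm_sum I (r : seq I) (P : pred I) (F : I -> 'rV[R]_d) :
  enorm (\sum_(i <- r | P i) F i) <= \sum_(i <- r | P i) enorm (F i).
Proof.
elim/big_ind2: _ => [|a u b v ua vb|//]; first by rewrite enorm0.
by rewrite (le_trans (enormD _ _))// lerD.
Qed.

Lemma sqr_enormB u v :
  enorm (u - v) ^+ 2 = enorm u ^+ 2 - 2 * dot u v + enorm v ^+ 2.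
Proof.
by rewrite !sqr_enorm !(dotDl, dotDr, dotNl, dotNr) (dotC v u); ring.
Qed.

Lemma sqr_enormD_le u v :
  enorm (u + v) ^+ 2 <= 2 * enorm u ^+ 2 + 2 * enorm v ^+ 2.
Proof.
have := dot_ge0 (u - v); rewrite !sqr_enorm.
rewrite !(dotDl, dotDr, dotNl, dotNr) (dotC v u) => ?; lra.
Qed.

(** The test vector that gives the bound is [u] itself. This is how norm bounds
    are drawn from scalar ones, such as those of the mean value theorem. *)
Lemma enorm_le_dual u (c : R) :
  0 <= c -> (forall v, dot v u <= c * enorm v) -> enorm u <= c.
Proof.
move=> c0 /(_ u); rewrite -sqr_enorm expr2.
have [->//|u0] := eqVneq (enorm u) 0.
by rewrite ler_pM2r// lt0r u0 enorm_ge0.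
Qed.

Lemma dot_delta u i : dot u (delta_mx 0 i) = u 0 i.
Proof.
rewrite /dot (bigD1 i)//= mxE !eqxx mulr1 big1 ?addr0// => j ji.
by rewrite mxE (negPf ji) andbF mulr0.
Qed.

Lemma enorm_mulmx_bounded A : exists c, forall v, enorm (v *m A) <= c * enorm v.
Proof.
exists (\sum_(i < d) enorm (row i A)) => v.
rewrite mulmx_sum_row (le_trans (enorm_sum _ _ _))// mulr_suml ler_sum// => i _.
rewrite enormZ mulrC ler_wpM2l ?enorm_ge0// -(dot_delta v i).
apply: le_trans (norm_dot_le _ _) _; rewrite [enorm (delta_mx _ _)]enormE.
by rewrite dot_delta mxE !eqxx sqrtr1 mulr1.
Qed.

Lemma mulmx_ball_bounded A :
  has_ubound [set enorm (v *m A) | v in [set v : 'rV[R]_d | enorm v <= 1]].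
Proof.
have [c cA] := enorm_mulmx_bounded A; exists `|c| => _ [w /= w1 <-].
apply: le_trans (cA w) _; apply: le_trans (ler_norm _) _.
by rewrite normrM ler_piMr// ger0_norm ?enorm_ge0.
Qed.

Lemma enorm_mulmx_le A v : enorm (v *m A) <= spectral_norm A * enorm v.
Proof.
have [v0|v0] := eqVneq (enorm v) 0.
  by rewrite v0 (enorm0_eq0 v0) mul0mx enorm0 mulr0.
have v_gt0 : 0 < enorm v by rewrite lt0r v0 enorm_ge0.
rewrite -ler_pdivrMr//; apply: ub_le_sup; first exact: mulmx_ball_bounded.
exists ((enorm v)^-1 *: v) => /=.
  by rewrite enormZ gtr0_norm ?invr_gt0// mulVf.
by rewrite -scalemxAl enormZ gtr0_norm ?invr_gt0// mulrC.
Qed.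

Lemma spectral_norm_ge0 A : 0 <= spectral_norm A.
Proof.
apply: ub_le_sup; first exact: mulmx_ball_bounded.
by exists 0; rewrite /= ?mul0mx ?enorm0.
Qed.

End Euclidean.

(** * Mean value theorems along a segment *)

Section Calculus.
Variables (R : realType) (d : nat).
Implicit Types (f : 'rV[R]_d -> R) (u v x y : 'rV[R]_d).

Lemma diff_grad f x v : differentiable f x -> 'd f x v = dot (grad f x) v.
Proof.
move=> df; rewrite {1}(row_sum_delta v) linear_sum; apply: eq_bigr => i _.
by rewrite linearZ_LR mxE deriveE// /GRing.scale/= mulrC.
Qed.

Lemma mvt01 (g dg : R -> R) : (forall t : R, is_derive t 1 g (dg t)) ->
  exists2 c : R, 0 <= c <= 1 & g 1 - g 0 = dg c.
Proof.
move=> Dg; have [|c c01 E] := @MVT _ g dg 0 1 ltr01 (fun t _ => Dg t).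
  apply: continuous_subspaceT => t; apply: differentiable_continuous.
  by apply/derivable1_diffP; case: (Dg t).
exists c; first by move: c01; rewrite in_itv/= => /andP[/ltW-> /ltW->].
by rewrite E subr0 mulr1.
Qed.

Lemma is_derive_line (f : 'rV[R]_d -> R) x v (t : R) :
  (forall z, differentiable f z) ->
  is_derive t 1 (fun t => f (x + t *: v)) ('d f (x + t *: v) v).
Proof.
move=> df; pose g t := f (x + t *: v).
have dl : is_diff t (fun t : R => x + t *: v) (fun t => t *: v).
  by apply: is_diff_eq; rewrite add0r.
have dc := is_diff_comp dl (differentiableP (df (x + t *: v))).
have dgt : differentiable g t by exact: ex_diff.
split; first exact/derivable1_diffP.
rewrite deriveE//.
have -> : 'd g t = ('d f (x + t *: v) \o (fun t => t *: v)) :> (R -> R).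
  exact: diff_val.
by rewrite /= scale1r.
Qed.

Lemma mvt_grad f x v : (forall z, differentiable f z) ->
  exists2 c : R, 0 <= c <= 1 & f (x + v) - f x = dot (grad f (x + c *: v)) v.
Proof.
move=> df; have [c c01] := mvt01 (fun t => is_derive_line x v t df).
rewrite scale1r scale0r addr0 => E; exists c => //.
by rewrite E diff_grad.
Qed.

Lemma differentiable_dot u x : differentiable (dot u) x.
Proof.
have -> : dot u = \sum_(i < d) (fun v : 'rV[R]_d => u 0 i *: (v 0 i : R)).
  by apply/funext => v; rewrite fct_sumE.
apply: differentiable_sum => i; apply: differentiableZ.
exact: differentiable_coord.
Qed.

Lemma diff_dot u x : 'd (dot u) x = dot u :> ('rV[R]_d -> R).
Proof.
have lin : linear (dot u : 'rV[R]_d -> R^o).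
  by move=> a v w; rewrite dotDr dotZr.
pose h := GRing.isLinear.Build _ _ _ _ (dot u : 'rV[R]_d -> R^o) lin.
pose l : {linear 'rV[R]_d -> R^o} := HB.pack (dot u : 'rV[R]_d -> R^o) h.
have : continuous l.
  move=> y; apply: differentiable_continuous; exact: differentiable_dot.
by move=> /(diff_lin x).
Qed.

(** A vector-valued map has no mean value theorem, but each of its components
    has one; the intermediate point depends on [u]. *)
Lemma mvt_hess f u x v : (forall z, differentiable (grad f) z) ->
  exists2 c : R, 0 <= c <= 1 &
    dot u (grad f (x + v) - grad f x) = dot u (v *m hess f (x + c *: v)).
Proof.
move=> dg.
have dug z : differentiable (dot u \o grad f) z.
  by apply: differentiable_comp => //; exact: differentiable_dot.
have [c c01] := mvt01 (fun t => is_derive_line x v t dug).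
rewrite /= scale1r scale0r addr0 dotBr => E; exists c => //.
rewrite E diff_comp//; last exact: differentiable_dot.
by rewrite /= diff_dot /hess -deriveEjacobian ?deriveE.
Qed.

(** Plays the part of a limit as [h] tends to 0 wherever the error is known to
    be linear in [h]. *)
Lemma le_of_le_small (a b c : R) :
  (forall h, 0 < h <= 1 -> a <= b + h * c) -> a <= b.
Proof.
move=> abc; apply/ler_addgt0Pr => e e0.
have c1 : 0 < 1 + `|c| by rewrite ltr_pwDl.
pose h := Num.min 1 (e / (1 + `|c|)).
have h0 : 0 < h by rewrite lt_min ltr01 divr_gt0.
apply: le_trans (abc h _) _; first by rewrite h0 ge_min lexx.
rewrite lerD2l; apply: (@le_trans _ _ (h * (1 + `|c|))).
  by rewrite ler_pM2l// (le_trans (ler_norm c))// lerDr.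
by rewrite -ler_pdivlMr// /h ge_min lexx orbT.
Qed.

End Calculus.

(** * Smooth and convex functions *)
Local Opaque dot enorm grad hess.

Section Smooth.
Variables (R : realType) (d : nat) (f : 'rV[R]_d -> R) (L : R).
Hypotheses (L_ge0 : 0 <= L) (df : forall x, differentiable f x).
Hypothesis smf : smooth L f.

Lemma smooth_increment (x v : 'rV[R]_d) (t : R) : 0 <= t <= 1 ->
  `|dot (grad f (x + t *: v)) v - dot (grad f x) v| <= t * (L * enorm v ^+ 2).
Proof.
move=> /andP[t0 _]; rewrite -dotBl (le_trans (norm_dot_le _ _))//.
apply: le_trans (ler_wpM2r (enorm_ge0 v) (smf _ _)) _.
by rewrite addrAC subrr add0r enormZ ger0_norm// expr2 !mulrA (mulrC t).
Qed.

Lemma smooth_upper_bound (x v : 'rV[R]_d) :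
  f (x + v) <= f x + dot (grad f x) v + L * enorm v ^+ 2.
Proof.
have [c c01 E] := mvt_grad x v df.
have /ler_normlP[_ H] := smooth_increment x v c01.
move/andP: c01 => [c0 c1].
have : c * (L * enorm v ^+ 2) <= L * enorm v ^+ 2.
  by rewrite ler_piMl// mulr_ge0// sqr_ge0.
lra.
Qed.

(** The difference quotient of [f] along [y - x] is at most [f y - f x] by
    convexity, and at step [h] it differs from the slope at [x] by at most
    [h L |y - x|^2] by smoothness. *)
Lemma convex_ge_tangent : convex_function [set: 'rV[R]_d] f ->
  forall x y, f x + dot (grad f x) (y - x) <= f y.
Proof.
move=> cf x y; set v := y - x.
apply: (@le_of_le_small _ _ _ (L * enorm v ^+ 2)) => h /andP[h0 h1].
have h01 : 0 <= h <= 1 by rewrite (ltW h0) h1.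
have := cf (Itv01 (ltW h0) h1) y x (mem_setT _) (mem_setT _).
rewrite /conv/= /conv/= /unstable.onem /GRing.scale/= => cfh.
have E : h *: y + (1 - h) *: x = x + h *: v.
  by rewrite /v scalerBr scalerBl scale1r addrCA.
rewrite {}E in cfh.
have [c /andP[c0 c1] E] := mvt_grad x (h *: v) df.
have ch01 : 0 <= c * h <= 1 by rewrite mulr_ge0 ?(ltW h0)// mulr_ile1// ltW.
have /ler_normlP[H _] := smooth_increment x v ch01.
rewrite dotZr scalerA in E.
have {}cfh : h * dot (grad f (x + (c * h) *: v)) v <= h * (f y - f x) by lra.
rewrite ler_pM2l// in cfh.
have : c * h * (L * enorm v ^+ 2) <= h * (L * enorm v ^+ 2).
  by rewrite ler_wpM2r ?(mulr_ge0 L_ge0 (sqr_ge0 _))// ler_piMl// ltW.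
lra.
Qed.

(** The step from [x] by [- grad f x / (2 L)] decreases [f] by at least
    [|grad f x|^2 / (4 L)], and cannot go below the minimum. *)
Lemma sqr_grad_le_gap xs x : 0 < L -> (forall y, f xs <= f y) ->
  enorm (grad f x) ^+ 2 <= 4 * L * (f x - f xs).
Proof.
move=> L0 /(_ (x + (- (2 * L)^-1) *: grad f x)) fmin.
have := le_trans fmin (smooth_upper_bound _ _).
rewrite dotZr enormZ normrN gtr0_norm ?invr_gt0 ?mulr_gt0// -sqr_enorm exprMn.
set g := enorm _ ^+ 2 => H.
have E : f x + - (2 * L)^-1 * g + L * ((2 * L)^-1 ^+ 2 * g) = f x - g / (4 * L).
  by field; rewrite gt_eqF.
rewrite E in H.
have : g / (4 * L) <= f x - f xs by lra.
by rewrite ler_pdivrMr ?mulr_gt0// mulrC.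
Qed.

Lemma grad_at_min xs : 0 < L -> (forall y, f xs <= f y) -> grad f xs = 0.
Proof.
move=> L0 fmin; apply/enorm0_eq0/eqP; rewrite -sqrf_eq0 eq_le sqr_ge0 andbT.
by rewrite (le_trans (sqr_grad_le_gap xs L0 fmin))// subrr mulr0.
Qed.

End Smooth.

Lemma le_transfer (R : realDomainType) (p q p' q' e : R) :
  `|p' - p| <= e -> `|q' - q| <= e -> p' = q' -> p <= q + 2 * e.
Proof. by move=> /ler_normlP[? ?] /ler_normlP[? ?] ?; lra. Qed.

Section Hessian.
Variables (R : realType) (d : nat) (f : 'rV[R]_d -> R) (LH : R).
Hypotheses (LH_ge0 : 0 <= LH) (df : forall x, differentiable f x).
Hypotheses (dgf : forall x, differentiable (grad f) x).
Hypothesis lipH : lipschitz_hess LH f.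
Implicit Types u v x y z : 'rV[R]_d.

Lemma hess_lipschitz x y v :
  enorm (v *m (hess f x - hess f y)) <= LH * enorm (x - y) * enorm v.
Proof.
apply: le_trans (enorm_mulmx_le _ _) _.
by rewrite ler_wpM2r ?enorm_ge0// lipH.
Qed.

(** The constant is 1 rather than the optimal 1/2, since the intermediate point
    is only known to lie on the segment; the rate leaves room for this. *)
Lemma grad_taylor x v :
  enorm (grad f (x + v) - grad f x - v *m hess f x) <= LH * enorm v ^+ 2.
Proof.
apply: enorm_le_dual => [|u]; first by rewrite mulr_ge0// sqr_ge0.
have [c /andP[c0 c1] E] := mvt_hess u x v dgf.
rewrite dotBr E -dotBr -mulmxBr (le_trans (dot_le_enorm _ _))// mulrC.
rewrite ler_wpM2r ?enorm_ge0// (le_trans (hess_lipschitz _ _ _))//.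
rewrite addrAC subrr add0r enormZ ger0_norm// expr2 !mulrA.
rewrite !ler_wpM2r ?enorm_ge0//.
by rewrite ler_piMr.
Qed.

(** Divide the expansion of the gradient along [h v] by [h]. *)
Lemma hess_bound (L : R) x v :
  smooth L f -> enorm (v *m hess f x) <= L * enorm v.
Proof.
move=> smf; apply: (@le_of_le_small _ _ _ (LH * enorm v ^+ 2)) => h /andP[h0 h1].
rewrite -(ler_pM2l h0) -{1}(gtr0_norm h0) -enormZ scalemxAl.
have := grad_taylor x (h *: v); have := smf (x + h *: v) x.
rewrite addrAC subrr add0r enormZ gtr0_norm// exprMn.
set a := grad f _ - _ => aL ta.
have -> : (h *: v) *m hess f x = a + (- (a - (h *: v) *m hess f x)).
  by rewrite opprB addrC subrK.
apply: le_trans (enormD _ _) _; rewrite enormN.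
nra.
Qed.

(** One mean value theorem along [u], for the increment of [f] by [v], and
    another along [v], for the gradient. *)
Lemma second_difference x u v : exists2 z, enorm (z - x) <= enorm u + enorm v &
  f (x + u + v) - f (x + u) - f (x + v) + f x = dot u (v *m hess f z).
Proof.
have D (t : R) : is_derive t 1 (fun t => f (x + v + t *: u) - f (x + t *: u))
    (dot (grad f (x + t *: u + v) - grad f (x + t *: u)) u).
  rewrite dotBl -!diff_grad// (addrAC x).
  by apply: is_deriveB; exact: is_derive_line.
have [c /andP[c0 c1] E] := mvt01 D.
have [c' /andP[c'0 c'1] E'] := mvt_hess u (x + c *: u) v dgf.
exists (x + c *: u + c' *: v).
  rewrite -[x + _ + _]addrA addrAC subrr add0r (le_trans (enormD _ _))// !enormZ.
  by rewrite !ger0_norm// lerD// ler_piMl// enorm_ge0.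
rewrite -E' dotC -E !scale1r !scale0r !addr0 (addrAC x v).
by ring.
Qed.

(** Schwarz's theorem. The second difference of [f] along [h u] and [h v] does
    not depend on the order of [u] and [v]; since the Hessian is Lipschitz,
    either side of the equation is within a multiple of [h] of this difference
    divided by [h^2]. *)
Lemma hess_sym x u v : dot u (v *m hess f x) = dot v (u *m hess f x).
Proof.
wlog suff H : u v / dot u (v *m hess f x) <= dot v (u *m hess f x).
  by apply/eqP; rewrite eq_le !H.
pose C := LH * (enorm u + enorm v) * enorm u * enorm v.
apply: (@le_of_le_small _ _ _ (2 * C)) => h /andP[h0 h1].
have E a b : enorm (h *: a) + enorm (h *: b) = h * (enorm a + enorm b).
  by rewrite !enormZ gtr0_norm// mulrDr.
have [z zx Ez] := second_difference x (h *: u) (h *: v).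
have [z' zx' Ez'] := second_difference x (h *: v) (h *: u).
rewrite E in zx; rewrite {}E in zx'.
have : dot (h *: u) ((h *: v) *m hess f z) = dot (h *: v) ((h *: u) *m hess f z').
  by rewrite -Ez -Ez' (addrAC x); ring.
rewrite -!scalemxAl !dotZl !dotZr.
move=> /(mulfI (lt0r_neq0 h0)) /(mulfI (lt0r_neq0 h0)) {Ez Ez'} Ezz.
have dist a b y : enorm (y - x) <= h * (enorm a + enorm b) ->
    `|dot a (b *m hess f y) - dot a (b *m hess f x)| <=
      h * (LH * (enorm a + enorm b) * enorm a * enorm b).
  move=> yx; rewrite -dotBr -mulmxBr; apply: le_trans (norm_dot_le _ _) _.
  have H := ler_wpM2l LH_ge0 yx.
  have {}H := le_trans (hess_lipschitz y x b) (ler_wpM2r (enorm_ge0 b) H).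
  apply: le_trans (ler_wpM2l (enorm_ge0 a) H) _.
  by rewrite le_eqVlt; apply/orP; left; apply/eqP; ring.
have du := dist u v z zx; have dv := dist v u z' zx'.
have sym : LH * (enorm v + enorm u) * enorm v * enorm u = C.
  by rewrite /C; ring.
rewrite sym in dv.
by rewrite mulrCA; exact: le_transfer du dv Ezz.
Qed.
End Hessian.

Section Average.
Variables (R : realType) (d n : nat) (f : 'I_n -> 'rV[R]_d -> R).
Hypotheses (n_gt0 : (0 < n)%N) (df : forall i x, differentiable (f i) x).

Let nR_neq0 : n%:R != 0 :> R. Proof. by rewrite pnatr_eq0 -lt0n. Qed.

Let averageE : average f = n%:R^-1 *: (\sum_(i < n) f i : 'rV[R]_d -> R).
Proof. by apply/funext => x; rewrite /average fct_sumE. Qed.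

Lemma differentiable_average x : differentiable (average f) x.
Proof.
by rewrite averageE; apply: differentiableZ; exact: differentiable_sum.
Qed.

Lemma grad_average x : n%:R *: grad (average f) x = \sum_(i < n) grad (f i) x.
Proof.
apply/rowP => k; rewrite !mxE summxE averageE deriveZ; last first.
  by apply: derivable_sum => i; exact: diff_derivable.
rewrite derive_sum; last by move=> i; exact: diff_derivable.
rewrite /GRing.scale/= mulrA divff// mul1r.
by apply: eq_bigr => i _; rewrite mxE.
Qed.

Lemma smooth_average (L : R) : (forall i, smooth L (f i)) -> smooth L (average f).
Proof.
move=> smf x y; have n0 : 0 < n%:R :> R by rewrite ltr0n.
rewrite -(ler_pM2l n0) -{1}(gtr0_norm n0) -enormZ scalerBr !grad_average -sumrB.
rewrite (le_trans (enorm_sum _ _ _))//.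
rewrite mulr_natl -[n in _ *+ n]card_ord -sumr_const ler_sum// => i _.
exact: smf.
Qed.

Lemma average_ge_tangent x y :
  (forall i, f i x + dot (grad (f i) x) (y - x) <= f i y) ->
  average f x + dot (grad (average f) x) (y - x) <= average f y.
Proof.
move=> tan; have n0 : 0 < n%:R :> R by rewrite ltr0n.
rewrite -(ler_pM2l n0) mulrDr -dotZl grad_average dotC dot_sumr.
rewrite /average !mulrA divff// !mul1r -big_split ler_sum// => i _.
by rewrite dotC tan.
Qed.
End Average.

(** * The iterates of an epoch *)

Section Epoch.
Variables (R : realType) (d n : nat) (f : 'I_n -> 'rV[R]_d -> R) (gamma : R).
Implicit Types (s : 'S_n) (x : 'rV[R]_d).

Lemma epoch_iterateS s x (k : 'I_n) :
  epoch_iterate f gamma s k.+1 x =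
  epoch_iterate f gamma s k x
    - gamma *: grad (f (s k)) (epoch_iterate f gamma s k x).
Proof.
rewrite /epoch_iterate (take_nth k) ?size_enum_ord//.
by rewrite nth_ord_enum foldl_rcons.
Qed.

Lemma epoch_iterate_sum s x k : (k <= n)%N ->
  epoch_iterate f gamma s k x =
  x - gamma *: \sum_(j < n | (j < k)%N)
                 grad (f (s j)) (epoch_iterate f gamma s j x).
Proof.
elim: k => [_|k IH kn].
  by rewrite big_pred0// scaler0 subr0 /epoch_iterate take0.
rewrite (epoch_iterateS s x (Ordinal kn)) /= {1}IH 1?ltnW//.
rewrite [in RHS](bigD1 (Ordinal kn))//= scalerDr opprD addrA [RHS]addrAC.
congr (_ - _ *: _ - _); apply: eq_bigl => j.
by rewrite -val_eqE/= ltnS ltn_neqAle andbC.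
Qed.

(** Up to the factor [- gamma], the first-order change of the sum of the
    gradients over an epoch: the gradient used at step [j] acts, through the
    Hessian, on every later step [k]. *)
Definition second_order (a : 'I_n -> 'rV[R]_d) (H : 'I_n -> 'M[R]_d) s :=
  \sum_(k < n) \sum_(j < n | (j < k)%N) a (s j) *m H (s k).

Definition rev_perm : 'S_n := perm (@rev_ord_inj n).

(** In the reversed order each pair of components is visited the other way
    round, so that both orders together see all ordered pairs once. *)
Lemma second_order_rev a H s :
  second_order a H s + second_order a H (rev_perm * s)%g =
  \sum_q (\sum_p a p - a q) *m H q.
Proof.
rewrite /second_order.
have -> : \sum_(k < n) \sum_(j < n | (j < k)%N)
     a ((rev_perm * s)%g j) *m H ((rev_perm * s)%g k) =
    \sum_(k < n) \sum_(j < n | (k < j)%N) a (s j) *m H (s k).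
  rewrite (reindex_inj rev_ord_inj)/=; apply: eq_bigr => k _.
  rewrite (reindex_inj rev_ord_inj)/=; apply: eq_big => j.
    by rewrite ltn_sub2lE.
  by rewrite !permM !permE !rev_ordK.
rewrite -big_split [RHS](reindex_inj (@perm_inj _ s))/=.
apply: eq_bigr => k _; rewrite -!mulmx_suml -mulmxDl; congr (_ *m _).
rewrite [X in _ = X - _](reindex_inj (@perm_inj _ s))/=.
rewrite [in RHS](bigD1 k)//= [RHS]addrAC subrr add0r.
rewrite [RHS](bigID (fun j : 'I_n => (j < k)%N))/=.
congr (_ + _); apply: eq_bigl => j; rewrite -val_eqE/=.
  by case: ltngtP.
by case: ltngtP.
Qed.

End Epoch.

Section Drift.
Variables (R : realType) (d n : nat) (f : 'I_n -> 'rV[R]_d -> R).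
Variables (L LH gamma c : R) (x : 'rV[R]_d) (s : 'S_n).
Hypotheses (L_ge0 : 0 <= L) (LH_ge0 : 0 <= LH) (gamma_ge0 : 0 <= gamma).
Hypothesis (c_ge0 : 0 <= c).
Hypotheses (dgf : forall i z, differentiable (grad (f i)) z).
Hypotheses (smf : forall i, smooth L (f i)).
Hypotheses (lipH : forall i, lipschitz_hess LH (f i)).
Hypothesis small : 2 * (gamma * n%:R * L) <= 1.
Hypothesis grad_le : forall i, enorm (grad (f i) x) <= c.

Let y k := epoch_iterate f gamma s k x.
Let M := 2 * (gamma * n%:R) * c.

Let sum_cst_le (P : pred 'I_n) (a : R) : 0 <= a -> \sum_(j | P j) a <= n%:R * a.
Proof.
move=> a0; rewrite sumr_const -[leLHS]mulr_natl ler_wpM2r// ler_nat.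
by rewrite -[leqRHS]card_ord max_card.
Qed.

Let M_ge0 : 0 <= M.
Proof. by rewrite !mulr_ge0. Qed.

(** One half of [M] covers the gradients at [x]; the other half covers their
    drift, because [gamma n L] is at most 1/2. *)
Lemma epoch_drift k : (k <= n)%N -> enorm (y k - x) <= M.
Proof.
elim/ltn_ind: k => k IH kn; rewrite /y epoch_iterate_sum//.
rewrite addrAC subrr add0r enormN enormZ ger0_norm//.
apply: (@le_trans _ _ (gamma * (n%:R * (c + L * M)))); last first.
  rewrite [leLHS](_ : _ = M / 2 + gamma * n%:R * L * M); last first.
    by rewrite /M; field.
  have : (gamma * n%:R * L) * M <= 2^-1 * M.
    by rewrite ler_wpM2r// -div1r ler_pdivlMr// mulrC.
  lra.
rewrite ler_wpM2l// (le_trans (enorm_sum _ _ _))//.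
apply: le_trans (sum_cst_le (fun j : 'I_n => (j < k)%N) _); last first.
  by rewrite addr_ge0// mulr_ge0.
apply: ler_sum => j jk; rewrite -/(y j) -[X in enorm X](subrK (grad (f (s j)) x)).
rewrite (le_trans (enormD _ _))// addrC lerD//.
by rewrite (le_trans (smf _ _ _))// ler_wpM2l// IH// ltnW.
Qed.

Definition grad_drift := \sum_(k < n) (grad (f (s k)) (y k) - grad (f (s k)) x).

Lemma epoch_end : y n = x - gamma *: (\sum_i grad (f i) x + grad_drift).
Proof.
rewrite /y epoch_iterate_sum//; congr (_ - _ *: _).
rewrite [in RHS](reindex_inj (@perm_inj _ s)) -[in RHS]big_split/=.
by apply: eq_big => [j|j _]; rewrite ?ltn_ord// [RHS]addrC subrK.
Qed.

Lemma grad_drift_le : enorm grad_drift <= n%:R * (L * M).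
Proof.
rewrite (le_trans (enorm_sum _ _ _))//.
apply: le_trans (sum_cst_le xpredT _); last by rewrite mulr_ge0.
apply: ler_sum => k _; rewrite (le_trans (smf _ _ _))// ler_wpM2l//.
by rewrite epoch_drift// ltnW.
Qed.

(** To first order in [gamma], step [k] starts from the point displaced by the
    gradients met before it, each evaluated at [x]. *)
Lemma grad_drift_second_order :
  enorm (grad_drift + gamma *: second_order (fun i => grad (f i) x)
                                            (fun i => hess (f i) x) s)
  <= n%:R * (LH * M ^+ 2 + L * (gamma * (n%:R * (L * M)))).
Proof.
rewrite /grad_drift /second_order scaler_sumr -big_split/=.
rewrite (le_trans (enorm_sum _ _ _))//.
have b0 : 0 <= LH * M ^+ 2 + L * (gamma * (n%:R * (L * M))).
  by rewrite addr_ge0 ?mulr_ge0// sqr_ge0.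
apply: le_trans (sum_cst_le xpredT b0); apply: ler_sum => k _.
have kn : (k <= n)%N by rewrite ltnW.
rewrite -mulmx_suml scalemxAl.
set H := hess _ _; set A := grad _ _ - grad _ _; set S := \sum_(_ | _) _.
have -> : A + (gamma *: S) *m H =
    (A - (y k - x) *m H) + (y k - x + gamma *: S) *m H.
  by rewrite [(_ + gamma *: S) *m H]mulmxDl addrA subrK.
rewrite (le_trans (enormD _ _))// lerD//.
  have := grad_taylor LH_ge0 (dgf (s k)) (lipH (s k)) x (y k - x).
  rewrite (addrC x) subrK -/A -/H => /le_trans; apply.
  by rewrite ler_wpM2l// ler_pXn2r// ?nnegrE ?enorm_ge0// epoch_drift.
rewrite (le_trans (hess_bound LH_ge0 (dgf (s k)) (lipH (s k)) _ _ (smf (s k))))//.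
rewrite ler_wpM2l// /y epoch_iterate_sum// [x - _ - x]addrAC subrr add0r.
rewrite -scalerN -scalerDr enormZ ger0_norm// ler_wpM2l// addrC -sumrB.
rewrite (le_trans (enorm_sum _ _ _))//.
apply: le_trans (sum_cst_le (fun j : 'I_n => (j < k)%N) _); last first.
  by rewrite mulr_ge0.
apply: ler_sum => j jk; rewrite enormB (le_trans (smf _ _ _))// ler_wpM2l//.
by rewrite epoch_drift// ltnW.
Qed.
End Drift.

(** * The distance to the minimizer over an epoch *)

(** Here [z] is the total step of an epoch, [g] the norm of the gradient of the
    average, [phi] the optimality gap and [M] the drift bound. The left-hand side
    gathers the errors of an epoch except those of size [z^2 D B]. In the
    term in [LH], the bound [g <= G] is enough; elsewhere [g] is absorbed in the
    gap through [g^2 <= 4 L phi], which uses 3/4 + 1/64 + 1/8 of it. What remains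
    is proportional to [delta] or [eta]. *)
Lemma epoch_budget (R : realFieldType) (L LH D G delta z g phi eta M : R) :
  0 < L -> 0 <= LH -> 0 <= D -> 0 <= G -> 0 <= delta <= 2 * G ->
  0 < z -> 16 * (z * L) <= 1 -> 0 <= g <= G -> g ^+ 2 <= 4 * L * phi ->
  2 * G * LH * z ^+ 2 <= eta -> z ^+ 4 * L ^+ 4 <= eta ->
  M = 2 * z * (delta + g) ->
  2 * z * D * (LH * M ^+ 2 + z * L ^+ 2 * M) + 3 * z ^+ 2 * g ^+ 2
    + 2 * z ^+ 2 * L ^+ 2 * M ^+ 2
  <= z * phi + z * ((2 * G * L + 4 * D * L ^+ 2) * (z ^+ 2 * delta)
                    + (36 * D * G + 128 * D ^+ 2 * L) * eta).
Proof.
move=> L0 LH0 D0 G0 /andP[de0 deG] z0 zL /andP[g0 gG] gphi eta1 eta2 ->.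
have phi0 : 0 <= phi.
  by rewrite -(pmulr_rge0 _ (_ : 0 < 4 * L)) ?mulr_gt0// (le_trans (sqr_ge0 g)).
have zL0 : 0 < z * L by rewrite mulr_gt0.
have t1 : z * g ^+ 2 <= phi / 4.
  have : z * g ^+ 2 <= z * (4 * L * phi) by rewrite ler_pM2l.
  have : (16 * (z * L)) * phi <= 1 * phi by rewrite ler_wpM2r.
  by clear -z0; lra.
have sq : (delta + g) ^+ 2 <= 2 * delta ^+ 2 + 2 * g ^+ 2.
  by have := sqr_ge0 (delta - g); clear; nra.
have zL2 : 0 <= (z * L) ^+ 2 by exact: sqr_ge0.
have zL2' : (z * L) ^+ 2 <= 256^-1.
  rewrite (_ : 256^-1 = (16^-1) ^+ 2); last by field.
  rewrite ler_pXn2r// ?nnegrE ?(ltW zL0)// ?invr_ge0//.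
  by clear -zL; lra.
have t2a : z * (z * L) ^+ 2 * g ^+ 2 <= phi / 1024.
  have := ler_pM (mulr_ge0 (ltW z0) (sqr_ge0 g)) zL2 t1 zL2'.
  by clear; lra.
have t2b : z * (z * L) ^+ 2 * delta ^+ 2 <= G * L / 8 * (z ^+ 2 * delta).
  rewrite [leLHS](_ : _ = (z * L * delta) * (L * (z ^+ 2 * delta))); last by ring.
  rewrite [leRHS](_ : _ = (16^-1 * (2 * G)) * (L * (z ^+ 2 * delta))); last by field.
  have h1 : 0 <= L * (z ^+ 2 * delta) by rewrite !mulr_ge0 ?sqr_ge0// ltW.
  have h2 : z * L <= 16^-1 by clear -zL; lra.
  by rewrite ler_wpM2r// (ler_pM (ltW zL0) de0 h2 deG).
have t2 : 2 * z * L ^+ 2 * (2 * z * (delta + g)) ^+ 2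
    <= phi / 64 + 2 * G * L * (z ^+ 2 * delta).
  have : z * (z * L) ^+ 2 * (delta + g) ^+ 2 <=
      z * (z * L) ^+ 2 * (2 * delta ^+ 2 + 2 * g ^+ 2).
    by rewrite ler_wpM2l// mulr_ge0// ltW.
  by clear -t2a t2b; lra.
have t3 : 2 * D * (LH * (2 * z * (delta + g)) ^+ 2) <= 36 * D * G * eta.
  have h1 : (delta + g) ^+ 2 <= (3 * G) ^+ 2.
    by rewrite ler_pXn2r// ?nnegrE ?addr_ge0 ?mulr_ge0//; clear -deG gG; lra.
  have h2 : D * (LH * z ^+ 2) * (delta + g) ^+ 2 <= D * (LH * z ^+ 2) * (3 * G) ^+ 2.
    by rewrite ler_wpM2l// !mulr_ge0// ltW.
  have h3 : D * G * (2 * G * LH * z ^+ 2) <= D * G * eta.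
    by rewrite ler_wpM2l// mulr_ge0.
  by clear -h2 h3; lra.
(* weighted so that the square of g takes an eighth of the gap *)
have t4 : 4 * D * L ^+ 2 * z ^+ 2 * g <= phi / 8 + 128 * D ^+ 2 * L * eta.
  have h1 : 32 * L * (4 * D * L ^+ 2 * z ^+ 2 * g) <=
      g ^+ 2 + (16 * L * (4 * D * L ^+ 2 * z ^+ 2)) ^+ 2.
    by have := sqr_ge0 (g - 16 * L * (4 * D * L ^+ 2 * z ^+ 2)); clear; lra.
  have h2 : D ^+ 2 * L * (z ^+ 4 * L ^+ 4) <= D ^+ 2 * L * eta.
    by rewrite ler_wpM2l// mulr_ge0 ?sqr_ge0// ltW.
  have h3 : (32 * L) * (4 * D * L ^+ 2 * z ^+ 2 * g) <=
     (32 * L) * (phi / 8 + 128 * D ^+ 2 * L * eta).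
    have : L * (D ^+ 2 * L * (z ^+ 4 * L ^+ 4)) <= L * (D ^+ 2 * L * eta).
      by rewrite ler_pM2l.
    by clear -h1 gphi; lra.
  by rewrite ler_pM2l ?mulr_gt0// in h3.
have : 2 * D * (LH * (2 * z * (delta + g)) ^+ 2 + z * L ^+ 2 * (2 * z * (delta + g)))
    + 3 * (z * g ^+ 2) + 2 * z * L ^+ 2 * (2 * z * (delta + g)) ^+ 2
    <= phi + ((2 * G * L + 4 * D * L ^+ 2) * (z ^+ 2 * delta)
                    + (36 * D * G + 128 * D ^+ 2 * L) * eta).
  by clear -t1 t2 t3 t4 phi0; lra.
move=> /(ler_wpM2l (ltW z0)); rewrite [leRHS]mulrDr; apply: le_trans.
by rewrite le_eqVlt; apply/orP; left; apply/eqP; ring.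
Qed.

Lemma epoch_pair_arith (R : realFieldType)
    (e1 e2 W z gamma n g phi d1 d2 D B L LH M E X : R) :
  z = gamma * n -> E = n * (LH * M ^+ 2 + L * (gamma * (n * (L * M)))) ->
  e1 <= W - 2 * z * phi + 2 * gamma ^+ 2 * d1 + 2 * gamma * D * E
    + gamma ^+ 2 * (2 * n ^+ 2 * g ^+ 2 + 2 * n ^+ 2 * (L * M) ^+ 2) ->
  e2 <= W - 2 * z * phi + 2 * gamma ^+ 2 * d2 + 2 * gamma * D * E
    + gamma ^+ 2 * (2 * n ^+ 2 * g ^+ 2 + 2 * n ^+ 2 * (L * M) ^+ 2) ->
  gamma ^+ 2 * (d1 + d2) <= gamma ^+ 2 * (n ^+ 2 * (D * B + g ^+ 2)) ->
  2 * z * D * (LH * M ^+ 2 + z * L ^+ 2 * M) + 3 * z ^+ 2 * g ^+ 2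
    + 2 * z ^+ 2 * L ^+ 2 * M ^+ 2 <= z * phi + z * X ->
  (e1 + e2) / 2 <= W - z * phi + z ^+ 2 * (D * B) + z * X.
Proof. by move=> -> ->; lra. Qed.

Lemma pair_split (V : zmodType) (u v z t : V) :
  u - v = - t + (u - (v - z) - (z - t)).
Proof. by rewrite !opprB [RHS]addrC !addrA [RHS]addrAC addrK [RHS]addrAC addrK. Qed.

Section Descent.
Variables (R : realType) (d n : nat) (f : 'I_n -> 'rV[R]_d -> R).
Variables (L LH D G delta gamma : R) (xs x : 'rV[R]_d).
Hypotheses (n_gt0 : (0 < n)%N) (L_gt0 : 0 < L) (LH_ge0 : 0 <= LH).
Hypotheses (D_ge0 : 0 <= D) (G_ge0 : 0 <= G) (gamma_gt0 : 0 < gamma).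
Hypotheses (df : forall i z, differentiable (f i) z).
Hypotheses (dgf : forall i z, differentiable (grad (f i)) z).
Hypotheses (smf : forall i, smooth L (f i)).
Hypotheses (lipH : forall i, lipschitz_hess LH (f i)).
Hypotheses (xs_min : forall z, average f xs <= average f z).
Hypothesis (xD : enorm (x - xs) <= D).
Hypothesis gradG : forall i z, enorm (z - xs) <= D -> enorm (grad (f i) z) <= G.

Let w := x - xs.
Let N := grad (average f) x.
Let a i := grad (f i) x.
Let b i := grad (f i) xs.
Let H i := hess (f i) x.
Let Hs i := hess (f i) xs.
Let B := enorm (Delta f xs) + LH * L * D ^+ 2 + 2 * LH * D * G.

Let sum_a : \sum_i a i = n%:R *: N.
Proof. by rewrite grad_average. Qed.

Let sum_b : \sum_i b i = 0.
Proof.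
rewrite -grad_average// (grad_at_min (L := L))// ?scaler0//.
- exact: ltW.
- by move=> z; exact: differentiable_average.
- exact: smooth_average.
Qed.

Let nR1 : 1 <= n%:R :> R.
Proof. by rewrite ler1n. Qed.

Lemma grad_average_le : enorm N <= G.
Proof.
have n0 : 0 < n%:R :> R by rewrite ltr0n.
rewrite -(ler_pM2l n0) -{1}(gtr0_norm n0) -enormZ -sum_a.
rewrite (le_trans (enorm_sum _ _ _))//.
rewrite mulr_natl -[n in _ *+ n]card_ord -sumr_const ler_sum// => i _.
exact: gradG.
Qed.

(** The sum over [p] of the gradients at the minimizer is kept, although it
    vanishes, so that the left-hand side has the shape found at [x]. *)
Lemma Delta_sum :
  enorm (\sum_q (\sum_p b p - b q) *m Hs q) <= n%:R ^+ 2 * enorm (Delta f xs).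
Proof.
rewrite /Delta; set pairs := [set p : 'I_n * 'I_n | p.1 != p.2]%SET.
have -> : \sum_q (\sum_p b p - b q) *m Hs q =
    \sum_(p in pairs) grad (f p.2) xs *m hess (f p.1) xs.
  rewrite (eq_bigl (fun p : 'I_n * 'I_n => true && (p.1 != p.2))); last first.
    by move=> p; rewrite inE.
  rewrite -(pair_big_dep xpredT (fun q p => q != p)
    (fun q p => grad (f p) xs *m hess (f q) xs))/=.
  apply: eq_bigr => q _; rewrite -mulmx_suml (bigD1 q)//= addrAC subrr add0r.
  by congr (_ *m _); apply: eq_bigl => p; rewrite eq_sym.
set S := \sum_(_ in _) _.
rewrite enormZ ger0_norm ?invr_ge0//.
have [p0|p0] := eqVneq #|pairs| 0%N.
  have -> : S = 0.
    by rewrite /S big_pred0// => p; exact: (card0_eq p0).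
  by rewrite enorm0 !mulr0.
rewrite mulrA ler_peMl ?enorm_ge0// ler_pdivlMr ?ltr0n ?lt0n// mul1r.
rewrite -natrX ler_nat (leq_trans (max_card _))//.
by rewrite card_prod card_ord mulnn.
Qed.

(** The gradients [a_p] and Hessians [H_q] at [x] are compared with their values
    [b_p] and [Hs_q] at the minimizer, for which the average of [b_p Hs_q] over
    distinct indices is [Delta]. Two of the errors are too large to be bounded
    by norms. In [<w, N H_q>] the symmetry of
    [H_q] moves the Hessian to [w], and [w H_q] is [a_q - b_q] up to a Taylor
    remainder, which gives [|N|^2]. The diagonal terms, absent from the sum over
    [p <> q], contribute [- <w H_q, a_q - b_q>], nonpositive up to the same
    remainder. *)
Lemma pair_sum_le :
  dot w (\sum_q (\sum_p a p - a q) *m H q) <=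
  n%:R ^+ 2 * (D * B + enorm N ^+ 2).
Proof.
pose c q := a q - b q; pose r q := w *m H q - c q.
have rE q : w *m H q = c q + r q by rewrite addrC subrK.
have xw : x - w = xs by rewrite /w opprB addrC subrK.
have r_le q : enorm (r q) <= LH * D ^+ 2.
  have := grad_taylor LH_ge0 (dgf q) (lipH q) x (- w).
  rewrite xw -/(a q) -/(b q) mulNmx opprK => h.
  have <- : b q - a q + w *m H q = r q by rewrite /r opprB addrC.
  apply: le_trans h _.
  by rewrite ler_wpM2l// enormN ler_pXn2r// ?nnegrE ?enorm_ge0.
have bG q : enorm (b q) <= G by apply: gradG; rewrite subrr enorm0.
have split : \sum_q (\sum_p a p - a q) *m H q =
    \sum_q (\sum_p b p - b q) *m Hs q +
    \sum_q ((n%:R *: N) *m H q - c q *m H q - b q *m (H q - Hs q)).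
  rewrite -big_split; apply: eq_bigr => q _ /=.
  rewrite sum_a sum_b sub0r [LHS]mulmxBl [c q *m _]mulmxBl mulmxBr mulNmx.
  exact: pair_split.
have term q : dot w ((n%:R *: N) *m H q - c q *m H q - b q *m (H q - Hs q)) <=
    n%:R * dot N (c q) + n%:R * (G * (LH * D ^+ 2)) +
    (L * D * (LH * D ^+ 2) + D * (LH * D * G)).
  have symH u v : dot u (v *m H q) = dot v (u *m H q).
    exact: (hess_sym LH_ge0 (df q) (dgf q) (lipH q)).
  rewrite 2!dotBr (symH w (c q)) (symH w (n%:R *: N)) rE.
  rewrite (dotDr (n%:R *: N)) (dotDr (c q)) !dotZl -sqr_enorm.
  have h1 := norm_dot_le N (r q); have h2 := norm_dot_le (c q) (r q).
  have h3 := norm_dot_le w (b q *m (H q - Hs q)).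
  have {}h1 : dot N (r q) <= G * (LH * D ^+ 2).
    apply: le_trans (le_trans (ler_norm _) h1) _.
    by rewrite ler_pM ?enorm_ge0// grad_average_le.
  have {}h2 : - dot (c q) (r q) <= L * D * (LH * D ^+ 2).
    rewrite (le_trans (ler_norm _))// normrN (le_trans h2)// ler_pM ?enorm_ge0//.
    by rewrite (le_trans (smf _ _ _))// ler_wpM2l// ltW.
  have {}h3 : - dot w (b q *m (H q - Hs q)) <= D * (LH * D * G).
    rewrite (le_trans (ler_norm _))// normrN (le_trans h3)// ler_pM ?enorm_ge0//.
    rewrite (le_trans (hess_lipschitz (lipH q) _ _ _))//.
    by rewrite ler_pM ?mulr_ge0 ?enorm_ge0// ler_wpM2l.
  have {}h1 := ler_wpM2l (ler0n R n) h1.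
  have := sqr_ge0 (enorm (c q)).
  lra.
rewrite split dotDr.
have t1 : dot w (\sum_q (\sum_p b p - b q) *m Hs q) <=
    n%:R ^+ 2 * (D * enorm (Delta f xs)).
  apply: le_trans (dot_le_enorm _ _) _; rewrite mulrCA.
  by rewrite ler_pM ?enorm_ge0// Delta_sum.
have sum_c : \sum_q c q = n%:R *: N by rewrite sumrB sum_a sum_b subr0.
have t2 : dot w (\sum_q ((n%:R *: N) *m H q - c q *m H q - b q *m (H q - Hs q))) <=
    n%:R ^+ 2 * enorm N ^+ 2 + n%:R ^+ 2 * (G * (LH * D ^+ 2)) +
    n%:R * (L * D * (LH * D ^+ 2) + D * (LH * D * G)).
  rewrite dot_sumr; apply: le_trans (ler_sum _ (fun q _ => term q)) _.
  rewrite big_split [X in X + _ <= _]big_split/= -mulr_sumr -dot_sumr sum_c dotZr.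
  rewrite -sqr_enorm !sumr_const card_ord.
  by rewrite le_eqVlt; apply/orP; left; apply/eqP; ring.
have t3 : n%:R * (L * D * (LH * D ^+ 2) + D * (LH * D * G)) <=
   n%:R ^+ 2 * (L * D * (LH * D ^+ 2) + D * (LH * D * G)).
  rewrite ler_wpM2r ?expr2 ?ler_peMl//.
  by rewrite !(addr_ge0, mulr_ge0)// ?sqr_ge0// ltW.
apply: le_trans (lerD t1 (le_trans t2 (lerD (lexx _) t3))) _.
by rewrite le_eqVlt; apply/orP; left; apply/eqP; rewrite /B; ring.
Qed.
Hypotheses (delta_ge : forall i, enorm (N - a i) <= delta).
Hypotheses (delta_le : delta <= 2 * G).
Hypothesis (small : 16 * (gamma * n%:R * L) <= 1).
Hypothesis (tangent : average f x + dot N (xs - x) <= average f xs).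

Let gap := average f x - average f xs.
Let M := 2 * (gamma * n%:R) * (delta + enorm N).
Let E := n%:R * (LH * M ^+ 2 + L * (gamma * (n%:R * (L * M)))).

Let delta_ge0 : 0 <= delta.
Proof. exact: le_trans (enorm_ge0 _) (delta_ge (Ordinal n_gt0)). Qed.

Let c_ge0 : 0 <= delta + enorm N.
Proof. by rewrite addr_ge0 ?enorm_ge0. Qed.

Let a_le i : enorm (a i) <= delta + enorm N.
Proof.
rewrite -[a i](subrK N) (le_trans (enormD _ _))// lerD2r enormB.
exact: delta_ge.
Qed.

Let small2 : 2 * (gamma * n%:R * L) <= 1.
Proof.
have : 0 <= gamma * n%:R * L by rewrite !mulr_ge0// ltW.
by have := small; lra.
Qed.

Let dist_end s := enorm (epoch_iterate f gamma s n x - xs) ^+ 2.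

Lemma epoch_end_dist s :
  dist_end s <= enorm w ^+ 2 - 2 * (gamma * n%:R) * gap
    + 2 * gamma ^+ 2 * dot w (second_order a H s) + 2 * gamma * D * E
    + gamma ^+ 2 * (2 * n%:R ^+ 2 * enorm N ^+ 2 + 2 * n%:R ^+ 2 * (L * M) ^+ 2).
Proof.
have g0 := ltW gamma_gt0; have L0 := ltW L_gt0.
rewrite /dist_end epoch_end -/a sum_a.
set r := grad_drift f gamma x s.
have r1 : enorm r <= n%:R * (L * M).
  exact: (grad_drift_le s L0 g0 c_ge0 smf small2 a_le).
have r2 : enorm (r + gamma *: second_order a H s) <= E.
  exact: (grad_drift_second_order s L0 LH_ge0 g0 c_ge0 dgf smf lipH small2 a_le).
have -> : x - gamma *: (n%:R *: N + r) - xs = w - gamma *: (n%:R *: N + r).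
  by rewrite addrAC.
have r3 : - dot w (r + gamma *: second_order a H s) <= D * E.
  rewrite (le_trans (ler_norm _))// normrN (le_trans (norm_dot_le _ _))//.
  by rewrite ler_pM ?enorm_ge0.
have r4 : enorm (n%:R *: N + r) ^+ 2 <=
    2 * (n%:R ^+ 2 * enorm N ^+ 2) + 2 * (n%:R * (L * M)) ^+ 2.
  rewrite (le_trans (sqr_enormD_le _ _))// enormZ exprMn ger0_norm//.
  rewrite lerD2l ler_pM2l// ler_pXn2r// ?nnegrE ?enorm_ge0//.
  exact: le_trans (enorm_ge0 r) r1.
have r5 : gap <= dot w N.
  by have := tangent; rewrite -(opprB x) dotNr dotC -/w /gap; lra.
rewrite sqr_enormB enormZ exprMn real_normK ?num_real// dotZr dotDr dotZr.
rewrite dotDr dotZr in r3.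
have {}r3 := ler_wpM2l g0 r3.
have {}r4 := ler_wpM2l (sqr_ge0 gamma) r4.
have {}r5 := ler_wpM2l (mulr_ge0 g0 (ler0n R n)) r5.
move: r3 r4 r5.
move: (dot _ _) (dot _ _) (dot _ _) => d1 d2 d3; lra.
Qed.

(** The second-order sum of a single order has no useful sign or size; only the
    total over an order and its reversal is the sum over pairs bounded above. *)
Lemma epoch_pair_dist (eta : R) s :
  2 * G * LH * (gamma * n%:R) ^+ 2 <= eta -> (gamma * n%:R) ^+ 4 * L ^+ 4 <= eta ->
  (dist_end s + dist_end (rev_perm n * s)%g) / 2 <=
  enorm w ^+ 2 - gamma * n%:R * gap + (gamma * n%:R) ^+ 2 * (D * B)
  + gamma * n%:R * ((2 * G * L + 4 * D * L ^+ 2) * ((gamma * n%:R) ^+ 2 * delta)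
                    + (36 * D * G + 128 * D ^+ 2 * L) * eta).
Proof.
move=> eta1 eta2.
have := second_order_rev a H s; move: (rev_perm n * s)%g => s' both_orders.
have h1 := epoch_end_dist s; have h2 := epoch_end_dist s'.
have z0 : 0 < gamma * n%:R by rewrite mulr_gt0// ltr0n.
have Ng : enorm N ^+ 2 <= 4 * L * gap.
  apply: sqr_grad_le_gap => //; first exact: ltW.
  - by move=> z; exact: differentiable_average.
  - exact: smooth_average.
have h3 : gamma ^+ 2 * (dot w (second_order a H s) +
    dot w (second_order a H s')) <=
    gamma ^+ 2 * (n%:R ^+ 2 * (D * B + enorm N ^+ 2)).
  by rewrite -dotDr both_orders ler_wpM2l ?sqr_ge0// pair_sum_le.
have budget := @epoch_budget R L LH D G delta (gamma * n%:R) (enorm N) gap eta M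
  L_gt0 LH_ge0 D_ge0 G_ge0 _ z0 small _ Ng eta1 eta2 erefl.
rewrite delta_ge0 delta_le enorm_ge0 grad_average_le in budget.
exact: epoch_pair_arith erefl erefl h1 h2 h3 (budget isT isT).
Qed.
End Descent.

(** * Averaging over the permutations *)

Section Expectation.
Variables (R : realType) (n l : nat).
Implicit Types X Y : {ffun 'I_l -> 'S_n} -> R.

Let card_gt0 : 0 < #|{ffun 'I_l -> 'S_n}|%:R :> R.
Proof. by rewrite ltr0n; apply/card_gt0P; exists [ffun=> 1%g]. Qed.

Lemma expect_le X Y : (forall sigma, X sigma <= Y sigma) -> expect X <= expect Y.
Proof. by move=> XY; rewrite ler_pM2l ?invr_gt0// ler_sum. Qed.

Lemma expectD X Y : expect (fun sigma => X sigma + Y sigma) = expect X + expect Y.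
Proof. by rewrite /expect big_split mulrDr. Qed.

Lemma expectZ (a : R) X : expect (fun sigma => a * X sigma) = a * expect X.
Proof. by rewrite /expect -mulr_sumr mulrCA. Qed.

Lemma expect_cst (a : R) : expect (fun _ : {ffun 'I_l -> 'S_n} => a) = a.
Proof.
by rewrite /expect sumr_const -[X in _ * X]mulr_natl mulKf// gt_eqF.
Qed.

Lemma expect_sum I (r : seq I) (P : pred I) (X : I -> {ffun 'I_l -> 'S_n} -> R) :
  expect (fun sigma => \sum_(i <- r | P i) X i sigma) =
  \sum_(i <- r | P i) expect (X i).
Proof. by rewrite /expect exchange_big/= mulr_sumr. Qed.

Definition reverse_epoch (t : 'I_l) (sigma : {ffun 'I_l -> 'S_n}) :
    {ffun 'I_l -> 'S_n} :=
  [ffun u => if u == t then (rev_perm n * sigma u)%g else sigma u].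

Lemma reverse_epoch_inj t : injective (reverse_epoch t).
Proof.
move=> sigma tau /ffunP st; apply/ffunP => u; have := st u.
by rewrite !ffunE; case: eqP => // _; exact: mulgI.
Qed.

(** The uniform law on the permutations is invariant under reversal of the
    order in one epoch; nothing more is used of it. *)
Lemma expect_reverse t X :
  expect X = expect (fun sigma => (X sigma + X (reverse_epoch t sigma)) / 2).
Proof.
rewrite /expect -mulr_suml big_split/=.
rewrite -(reindex_inj (@reverse_epoch_inj t) (P := xpredT))/=.
by congr (_ * _); rewrite mulrDl -splitr.
Qed.

End Expectation.

Section Boundary.
Variables (R : realType) (d n l : nat) (f : 'I_n -> 'rV[R]_d -> R) (gamma : R).
Variable (x0 : 'rV[R]_d).

Lemma boundaryS (sigma : {ffun 'I_l -> 'S_n}) (t : 'I_l) :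
  boundary f gamma sigma x0 t.+1 =
  epoch_iterate f gamma (sigma t) n (boundary f gamma sigma x0 t).
Proof.
rewrite /boundary (take_nth t) ?size_enum_ord//.
by rewrite nth_ord_enum foldl_rcons.
Qed.

Lemma boundary_reverse (t : 'I_l) (sigma : {ffun 'I_l -> 'S_n}) k : (k <= t)%N ->
  boundary f gamma (reverse_epoch t sigma) x0 k = boundary f gamma sigma x0 k.
Proof.
elim: k => [_|k IH kt]; first by rewrite /boundary !take0.
have kl : (k < l)%N by exact: ltn_trans kt (ltn_ord t).
rewrite !(boundaryS _ (Ordinal kl))/= IH 1?ltnW// ffunE.
by rewrite -val_eqE/= ltn_eqF.
Qed.

Lemma iterate0 (sigma : {ffun 'I_l -> 'S_n}) t :
  iterate f gamma sigma x0 t 0 = boundary f gamma sigma x0 t.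
Proof. by rewrite /iterate /epoch_iterate take0. Qed.

End Boundary.

Lemma jensen_tangent (R : realType) (d l : nat) (F : 'rV[R]_d -> R)
    (x : 'I_l -> 'rV[R]_d) : (0 < l)%N ->
  (forall y z, F y + dot (grad F y) (z - y) <= F z) ->
  F (l%:R^-1 *: \sum_t x t) <= l%:R^-1 * \sum_t F (x t).
Proof.
move=> l0 tan; set y := l%:R^-1 *: _.
have lR : 0 < l%:R :> R by rewrite ltr0n.
have yE : l%:R *: y = \sum_t x t by rewrite scalerA divff ?scale1r// gt_eqF.
rewrite ler_pdivlMl//.
have := ler_sum (index_enum 'I_l) (fun t (_ : true) => tan y (x t)).
rewrite big_split/= -dot_sumr sumrB -yE !sumr_const card_ord scaler_nat subrr.
by rewrite dotC dot0l addr0 mulr_natl.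
Qed.

(** * Step size and rate *)

Section StepSize.
Variable R : realType.

(** [e] is the [m]-th root of [c / d], read as [+oo] when [d = 0]. *)
Definition root_spec (m : nat) (c d : R) (e : \bar R) :=
  [/\ (0 < e)%E,
      forall gamma, 0 <= gamma -> (gamma%:E <= e)%E -> gamma ^+ m * d <= c &
      forall gamma, 0 <= gamma -> gamma%:E = e -> gamma ^+ m * d = c].

Lemma root_spec_fin m c d r : (0 < m)%N -> 0 <= d -> 0 < r -> r ^+ m * d = c ->
  root_spec m c d r%:E.
Proof.
move=> m0 d0 r0 rc; split=> [|g g0|g g0 [->]//]; first by rewrite lte_fin.
by rewrite lee_fin -rc => gr; rewrite ler_wpM2r// ler_pXn2r// ?nnegrE// ltW.
Qed.

Lemma root_spec_infty m c : (0 < m)%N -> 0 < c -> root_spec m c 0 +oo%E.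
Proof. by move=> m0 c0; split=> // g g0 _; rewrite mulr0 ltW. Qed.

Lemma root_spec_poweR m c d : (0 < m)%N -> 0 < c -> 0 <= d ->
  root_spec m c d (poweR (c%:E / d%:E) (1 / m%:R))%E.
Proof.
move=> m0 c0; have mR : m%:R != 0 :> R by rewrite pnatr_eq0 -lt0n.
rewrite le0r => /orP[/eqP->|d0].
  rewrite inve0 gt0_muley ?lte_fin// poweRyr ?div1r ?invr_eq0//.
  exact: root_spec_infty.
rewrite inver gt_eqF// -EFinM poweR_EFin; apply: root_spec_fin => //.
- exact: ltW.
- by rewrite powR_gt0 ?divr_gt0.
- rewrite -powR_mulrn ?powR_ge0// -powRrM div1r mulVf// powRr1.
    by rewrite divfK// gt_eqF.
  by rewrite divr_ge0 ?ltW.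
Qed.

Lemma root_spec_sqrt c d : 0 < c -> 0 <= d -> root_spec 2 c d (sqrte (c%:E / d%:E)).
Proof.
move=> c0 d0; have := root_spec_poweR (isT : (0 < 2)%N) c0 d0.
rewrite div1r poweR12_sqrt// mule_ge0 ?lee_fin ?(ltW c0)//.
by rewrite inve_ge0 lee_fin.
Qed.

(** Each term of the minimum is used twice: as an upper bound on the step size,
    and, when it attains the minimum, to compute the inverse of the step size. *)
Lemma step_size_spec n T (L D delta B : R) :
  (0 < n)%N -> (0 < T)%N -> 0 < L -> 0 < D -> 0 <= delta -> 0 <= B ->
  let gamma := step_size n T L D delta B in
  [/\ 0 < gamma,
      [/\ gamma * (16 * n%:R * L) <= 1,
          gamma ^+ 2 * (T%:R * n%:R * B) <= D,
          gamma ^+ 3 * (T%:R * n%:R ^+ 2 * L ^+ 2 * delta) <= D &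
          gamma ^+ 4 * (T%:R * n%:R ^+ 3 * L ^+ 4) <= 1] &
      [\/ gamma * (16 * n%:R * L) = 1,
          gamma ^+ 2 * (T%:R * n%:R * B) = D,
          gamma ^+ 3 * (T%:R * n%:R ^+ 2 * L ^+ 2 * delta) = D |
          gamma ^+ 4 * (T%:R * n%:R ^+ 3 * L ^+ 4) = 1]].
Proof.
move=> n0 T0 L0 D0 de0 B0 gamma.
have nR : 0 < n%:R :> R by rewrite ltr0n.
have TR : 0 < T%:R :> R by rewrite ltr0n.
have s1 : root_spec 1 1 (16 * n%:R * L) (1%:E / (16 * n%:R * L)%:E)%E.
  have p0 : 0 < 16 * n%:R * L by rewrite !mulr_gt0.
  rewrite inver gt_eqF// -EFinM; apply: root_spec_fin => //.
  - exact: ltW.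
  - by rewrite mul1r invr_gt0.
  - by rewrite expr1 mul1r mulVf// gt_eqF.
have p2 : 0 <= T%:R * n%:R * B by rewrite !mulr_ge0// ltW.
have s2 := root_spec_sqrt D0 p2.
have p3 : 0 <= T%:R * n%:R ^+ 2 * L ^+ 2 * delta.
  by rewrite !mulr_ge0// ltW.
have s3 := root_spec_poweR (isT : (0 < 3)%N) D0 p3.
have p4 : 0 <= T%:R * n%:R ^+ 3 * L ^+ 4 by rewrite !mulr_ge0// ltW.
have s4 := root_spec_poweR (isT : (0 < 4)%N) ltr01 p4.
move: s1 s2 s3 s4; rewrite /gamma /step_size {gamma}.
set e1 := (1%:E / _)%E; set e2 := sqrte _; set e3 := poweR _ _; set e4 := poweR _ _.
move=> [e1_gt0 le1 eq1] [e2_gt0 le2 eq2] [e3_gt0 le3 eq3] [e4_gt0 le4 eq4].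
set e := Order.min _ _.
have e_gt0 : (0 < e)%E by rewrite !lt_min e1_gt0 e2_gt0 e3_gt0.
have e_fin : e \is a fin_num.
  rewrite ge0_fin_numE ?(ltW e_gt0)//; apply: (@le_lt_trans _ _ e1).
    by rewrite ge_min lexx.
  by rewrite /e1 inver gt_eqF ?mulr_gt0// -EFinM ltry.
have g_gt0 : 0 < fine e by rewrite fine_gt0// e_gt0 ltey_eq e_fin.
have g_ge0 := ltW g_gt0.
have [ee1 ee2 ee3 ee4] :
    [/\ (e <= e1)%E, (e <= e2)%E, (e <= e3)%E & (e <= e4)%E].
  by split; rewrite /e !ge_min lexx ?orbT.
have : [\/ e = e1, e = e2, e = e3 | e = e4].
  rewrite /e; case: (leP e1) => _; first exact: Or41.
  case: (leP e2) => _; first exact: Or42.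
  by case: (leP e3) => _; [exact: Or43|exact: Or44].
have eE := fineK e_fin; move: ee1 ee2 ee3 ee4; rewrite -eE.
move=> /(le1 _ g_ge0) h1 /(le2 _ g_ge0) h2 /(le3 _ g_ge0) h3 /(le4 _ g_ge0) h4 cases.
split => //.
case: cases.
- by move=> /(eq1 _ g_ge0); exact: Or41.
- by move=> /(eq2 _ g_ge0); exact: Or42.
- by move=> /(eq3 _ g_ge0); exact: Or43.
- by move=> /(eq4 _ g_ge0); exact: Or44.
Qed.
End StepSize.

Section Rate.
Variable R : realType.

Lemma le_of_pow_le m (a b : R) : (0 < m)%N -> 0 <= a -> 0 <= b ->
  a ^+ m <= b ^+ m -> a <= b.
Proof. by move=> m0 a0 b0; rewrite ler_pXn2r ?nnegrE. Qed.

Lemma powR_cancel m (a : R) : (0 < m)%N -> 0 <= a -> (a `^ (1 / m%:R)) ^+ m = a.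
Proof.
move=> m0 a0; rewrite -powR_mulrn ?powR_ge0// -powRrM div1r mulVf ?powRr1//.
by rewrite pnatr_eq0 -lt0n.
Qed.

(** Let [S] be the square root of [D B / l]. The second term of the minimum
    bounds [z D B] by [D S], and when it attains the minimum [D^2 / (z l)] is
    equal to [D S]; this gives the leading term of the rate. When another term
    attains the minimum, [D^2 / (z l)] is of the order of the remainder. The two
    powers 1/3 among the constants both come from the third term: one from its
    inverse, the other from its use as an upper bound on [z]. *)
Lemma rate_bound (L D B delta z l K1 K2 : R) :
  0 < L -> 0 < D -> 0 <= B -> 0 <= delta -> 0 < z -> 1 <= l -> 0 <= K1 -> 0 <= K2 ->
  z ^+ 2 * (l * B) <= D -> z ^+ 3 * (l * L ^+ 2 * delta) <= D ->
  [\/ 16 * (z * L) = 1, z ^+ 2 * (l * B) = D,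
      z ^+ 3 * (l * L ^+ 2 * delta) = D | z ^+ 4 * (l * L ^+ 4) = 1] ->
  D ^+ 2 / (z * l) + z * (D * B) + K1 * (z ^+ 2 * delta) + K2 / l <=
  2 * D * Num.sqrt (D * B / l) +
  (16 * L * D ^+ 2 + D ^+ 2 * L + D ^+ 2 * (L ^+ 2 / D) `^ (1 / 3)
    + K1 * ((D / L ^+ 2) `^ (1 / 3)) ^+ 2 + K2) *
    (l^-1 `^ (2 / 3) * delta `^ (1 / 3) + l^-1 `^ (3 / 4)).
Proof.
move=> L0 D0 B0 de0 z0 l1 K10 K20 z2 z3 cases.
set p := (L ^+ 2 / D) `^ _; set p' := (D / L ^+ 2) `^ _.
have l0 : 0 < l by exact: lt_le_trans l1.
have li0 : 0 <= l^-1 by rewrite invr_ge0 ltW.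
set S := Num.sqrt _; have S0 : 0 <= S by exact: sqrtr_ge0.
have S2 : S ^+ 2 = D * B / l by rewrite sqr_sqrtr// divr_ge0 ?mulr_ge0// ltW.
pose u := l^-1 `^ (1 / 3); set v := delta `^ (1 / 3).
have u0 : 0 <= u by exact: powR_ge0.
have v0 : 0 <= v by exact: powR_ge0.
have p0 : 0 <= p by exact: powR_ge0.
have p'0 : 0 <= p' by exact: powR_ge0.
have u3 : u ^+ 3 = l^-1 by exact: (@powR_cancel 3).
have v3 : v ^+ 3 = delta by exact: (@powR_cancel 3).
have p3 : p ^+ 3 = L ^+ 2 / D.
  by apply: (@powR_cancel 3) => //; rewrite divr_ge0 ?sqr_ge0// ltW.
have p'3 : p' ^+ 3 = D / L ^+ 2.
  by apply: (@powR_cancel 3) => //; rewrite divr_ge0 ?sqr_ge0// ltW.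
have -> : l^-1 `^ (2 / 3) = u ^+ 2.
  by rewrite /u -[RHS]powR_mulrn ?powR_ge0// -powRrM; congr (_ `^ _); field.
set e := l^-1 `^ (3 / 4); have e0 : 0 <= e by exact: powR_ge0.
have e4 : e ^+ 4 = l^-1 ^+ 3.
  rewrite /e -[LHS]powR_mulrn ?powR_ge0// -powRrM -[RHS]powR_mulrn//.
  by congr (_ `^ _); field.
have le_e : l^-1 <= e.
  apply: (@le_of_pow_le 4) => //; rewrite e4 [leLHS]exprS.
  by rewrite ler_piMl ?exprn_ge0// invf_le1.
have zl0 : 0 < z * l by rewrite mulr_gt0.
have LD0 : 0 <= L * D ^+ 2 by rewrite mulr_ge0 ?sqr_ge0// ltW.
have t2 : z * (D * B) <= D * S.
  rewrite mulrCA ler_pM2l//; apply: (@le_of_pow_le 2) => //.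
    by rewrite mulr_ge0// ltW.
  rewrite S2 ler_pdivlMr//.
  have := ler_wpM2r B0 z2; lra.
have t3 : z ^+ 2 * delta <= p' ^+ 2 * (u ^+ 2 * v).
  have zv : z * v <= p' * u.
    apply: (@le_of_pow_le 3) => //; rewrite ?mulr_ge0 ?(ltW z0)//.
    rewrite !exprMn v3 p'3 u3 ler_pdivlMr// ler_pdivlMr ?exprn_gt0//.
    move: z3; lra.
  have : (z * v) ^+ 2 * v <= (p' * u) ^+ 2 * v.
    by rewrite ler_wpM2r// ler_pXn2r// ?nnegrE ?mulr_ge0// ltW.
  by rewrite -v3 !exprMn; lra.
have t1 : D ^+ 2 / (z * l) <= D * S + 16 * L * D ^+ 2 * e + D ^+ 2 * L * e
    + D ^+ 2 * p * (u ^+ 2 * v).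
  have n1 : 0 <= D * S by rewrite mulr_ge0// ltW.
  have n2 : 0 <= L * D ^+ 2 * e by rewrite mulr_ge0.
  have n3 : 0 <= D ^+ 2 * p * (u ^+ 2 * v) by rewrite !mulr_ge0// ltW.
  have zl : 0 <= (z * l)^-1 by rewrite invr_ge0 ltW.
  have DD : 0 <= D ^+ 2 by exact: sqr_ge0.
  case: cases => c.
  - have : D ^+ 2 / (z * l) = 16 * (L * D ^+ 2 * l^-1).
      rewrite -[LHS]mulr1 -[X in _ * X = _]c; field; by rewrite !gt_eqF.
    have := ler_wpM2l LD0 le_e; lra.
  - have : D / (z * l) <= S.
      apply: (@le_of_pow_le 2) => //; first by rewrite mulr_ge0// ltW.
      have -> : (D / (z * l)) ^+ 2 = D * D / (z ^+ 2 * l ^+ 2).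
        by field; rewrite !gt_eqF.
      rewrite S2 -{2}c (_ : D * _ / _ = D * B / l)//.
      by field; rewrite !gt_eqF.
    move=> /(ler_wpM2l (ltW D0)); lra.
  - have : (z * l)^-1 <= p * (u ^+ 2 * v).
      apply: (@le_of_pow_le 3) => //; first by rewrite !mulr_ge0.
      rewrite 2!exprMn v3 exprAC u3 p3.
      have -> : (z * l)^-1 ^+ 3 = D / (D * z ^+ 3 * l ^+ 3).
        by field; rewrite !gt_eqF.
      rewrite -[X in X / _]c (_ : _ / _ = L ^+ 2 / D * (l^-1 ^+ 2 * delta))//.
      by field; rewrite !gt_eqF.
    move=> /(ler_wpM2l DD); lra.
  - have : (z * l)^-1 <= L * e.
      apply: (@le_of_pow_le 4) => //; first by rewrite mulr_ge0// ltW.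
      rewrite exprMn e4.
      have -> : (z * l)^-1 ^+ 4 = 1 / (z ^+ 4 * l ^+ 4).
        by field; rewrite !gt_eqF.
      rewrite -[X in X / _]c (_ : _ / _ = L ^+ 4 * l^-1 ^+ 3)//.
      by field; rewrite !gt_eqF.
    move=> /(ler_wpM2l DD); lra.
have t4 : K2 / l <= K2 * e by rewrite ler_wpM2l.
have {}t3 := ler_wpM2l K10 t3.
have n1 : 0 <= L * D ^+ 2 * (u ^+ 2 * v) by rewrite !mulr_ge0// ltW.
have n2 : 0 <= D ^+ 2 * p * e by rewrite !mulr_ge0// ltW.
have n3 : 0 <= K1 * p' ^+ 2 * e by rewrite !mulr_ge0.
have n4 : 0 <= K2 * (u ^+ 2 * v) by rewrite !mulr_ge0.
move: t1 t2 t3 t4 n1 n2 n3 n4; clear; lra.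
Qed.
End Rate.

(** * The expected optimality gap *)

Section Expected.
Variable R : realType.

(** Disposes of negative constants, which the hypotheses allow: the iterates then
    cannot leave the minimizer. *)
Lemma lipschitz_hess_lt0 (d : nat) (LH : R) (f : 'rV[R]_d -> R) :
  LH < 0 -> lipschitz_hess LH f -> forall x y : 'rV[R]_d, x = y.
Proof.
move=> LH0 lip x y; apply/eqP; rewrite -subr_eq0; apply/eqP/enorm0_eq0/eqP.
rewrite eq_le enorm_ge0 andbT -(@nmulr_rge0 _ LH)//.
exact: le_trans (spectral_norm_ge0 _) (lip x y).
Qed.

Variables (d n l : nat) (f : 'I_n -> 'rV[R]_d -> R) (x0 xs : 'rV[R]_d).
Variables (L LH D G delta gamma : R).
Hypotheses (n_gt0 : (0 < n)%N) (l_gt0 : (0 < l)%N).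
Hypotheses (L_gt0 : 0 < L) (LH_ge0 : 0 <= LH) (D_ge0 : 0 <= D) (G_ge0 : 0 <= G).
Hypothesis (gamma_gt0 : 0 < gamma).
Hypotheses (cf : forall i, convex_function [set: 'rV[R]_d] (f i)).
Hypotheses (df : forall i, twice_differentiable (f i)).
Hypotheses (smf : forall i, smooth L (f i)).
Hypotheses (lipH : forall i, lipschitz_hess LH (f i)).
Hypotheses (xs_min : forall z, average f xs <= average f z).
Hypothesis (delta_ge : forall i x,
  enorm (grad (average f) x - grad (f i) x) <= delta).
Hypothesis (delta_le : delta <= 2 * G).
Hypothesis (bounded : forall (sigma : {ffun 'I_l -> 'S_n}) (t : 'I_l),
  enorm (boundary f gamma sigma x0 t - xs) <= D).
Hypothesis gradG : forall i z, enorm (z - xs) <= D -> enorm (grad (f i) z) <= G.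
Hypothesis (small : 16 * (gamma * n%:R * L) <= 1).

Let B := enorm (Delta f xs) + LH * L * D ^+ 2 + 2 * LH * D * G.
Let z := gamma * n%:R.
Let pt (t : nat) (sigma : {ffun 'I_l -> 'S_n}) := boundary f gamma sigma x0 t.
Let gap t := expect (fun sigma => average f (pt t sigma) - average f xs).
Let dist t := expect (fun sigma => enorm (pt t sigma - xs) ^+ 2).

Let average_tangent x y :
  average f x + dot (grad (average f) x) (y - x) <= average f y.
Proof.
apply: average_ge_tangent => // [i w|i]; first exact: (df i).1.
exact: (convex_ge_tangent (ltW L_gt0) (df i).1 (smf i) (cf i)).
Qed.

Section Eta.
Variable eta : R.
Hypotheses (eta1 : 2 * G * LH * z ^+ 2 <= eta) (eta2 : z ^+ 4 * L ^+ 4 <= eta).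

Let K := z ^+ 2 * (D * B) + z * ((2 * G * L + 4 * D * L ^+ 2) * (z ^+ 2 * delta)
                    + (36 * D * G + 128 * D ^+ 2 * L) * eta).

Lemma expected_dist_step (t : 'I_l) : dist t.+1 + z * gap t <= dist t + K.
Proof.
rewrite /dist (expect_reverse t) -expectZ -(expect_cst n l K) -!expectD.
apply: expect_le => sigma; rewrite /pt !boundaryS boundary_reverse// ffunE eqxx.
have h := @epoch_pair_dist R d n f L LH D G delta gamma xs _ n_gt0 L_gt0 LH_ge0
  D_ge0 G_ge0 gamma_gt0 (fun i => (df i).1) (fun i => (df i).2) smf lipH xs_min
  (bounded sigma t) gradG (fun i => delta_ge i _) delta_le small
  (average_tangent _ _) eta (sigma t) eta1 eta2.
rewrite -lerBrDr (le_trans h)// /K /z /B.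
by rewrite le_eqVlt; apply/orP; left; apply/eqP; ring.
Qed.

Lemma expected_gap_sum : z * \sum_(t < l) gap t <= D ^+ 2 + l%:R * K.
Proof.
suff H m : (m <= l)%N ->
    dist m + z * \sum_(t < m) gap t <= D ^+ 2 + m%:R * K.
  apply: le_trans (H l (leqnn l)); rewrite lerDr -(expect_cst n l 0).
  by apply: expect_le => sigma; exact: sqr_ge0.
elim: m => [_|m IH ml].
  rewrite big_ord0 mulr0 mul0r !addr0 -(expect_cst n l (D ^+ 2)).
  apply: expect_le => sigma; rewrite ler_pXn2r// ?nnegrE ?enorm_ge0//.
  exact: (bounded sigma (Ordinal l_gt0)).
have := expected_dist_step (Ordinal ml); have := IH (ltnW ml).
rewrite big_ord_recr/= -natr1; lra.
Qed.

(** Telescoping over the epochs, then convexity at the mean of the points. *)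
Lemma expected_gap_xbar :
  expect (fun sigma : {ffun 'I_l -> 'S_n} =>
            average f (xbar f gamma x0 sigma)) - average f xs <=
  D ^+ 2 / (z * l%:R) + z * (D * B)
  + (2 * G * L + 4 * D * L ^+ 2) * (z ^+ 2 * delta)
  + (36 * D * G + 128 * D ^+ 2 * L) * eta.
Proof.
have lR : 0 < l%:R :> R by rewrite ltr0n.
have z0 : 0 < z by rewrite mulr_gt0// ltr0n.
have jensen :
    expect (fun sigma : {ffun 'I_l -> 'S_n} =>
              average f (xbar f gamma x0 sigma)) - average f xs <= l%:R^-1 * \sum_(t < l) gap t.
  rewrite -[X in _ - X](expect_cst n l) -[- _]mulN1r -expectZ -expectD.
  rewrite -expect_sum -expectZ; apply: expect_le => sigma.
  rewrite mulN1r sumrB sumr_const card_ord mulrBr.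
  rewrite -[average f xs *+ l]mulr_natl mulKf ?gt_eqF//.
  rewrite lerD2r /xbar; under eq_bigr do rewrite iterate0.
  exact: jensen_tangent.
apply: le_trans jensen _; rewrite ler_pdivrMl// -(ler_pM2l z0).
apply: le_trans expected_gap_sum _; rewrite /K le_eqVlt; apply/orP; left.
by apply/eqP; field; rewrite !gt_eqF.
Qed.

End Eta.
End Expected.

Theorem theorem6 (R : realType) (L LH D G : R)
    (L_gt0 : 0 < L) (D_gt0 : 0 < D) (G_gt0 : 0 < G) :
  exists C0 q : R, [/\ 0 < C0, 0 < q &
    forall (n d l T : nat) (f : 'I_n -> 'rV[R]_d -> R) (x0 xstar : 'rV[R]_d)
           (delta gamma : R),
    (2 <= n)%N -> (0 < l)%N -> T = (l * n)%N ->
    (forall i, convex_function [set: 'rV[R]_d] (f i)) ->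
    (forall i, twice_differentiable (f i)) ->
    (forall i, smooth L (f i)) ->
    (forall i, lipschitz_hess LH (f i)) ->
    (forall x, average f xstar <= average f x) ->
    (forall i x, enorm (grad (average f) x - grad (f i) x) <= delta) ->
    delta <= 2 * G ->
    gamma = step_size n T L D delta
              (enorm (Delta f xstar) + LH * L * D ^+ 2 + 2 * LH * D * G) ->
    (forall (sigma : {ffun 'I_l -> 'S_n}) (t : 'I_l) (k : nat), (k <= n)%N ->
       enorm (iterate f gamma sigma x0 t k - xstar) <= D) ->
    (forall i x, enorm (x - xstar) <= D -> enorm (grad (f i) x) <= G) ->
    expect (fun sigma : {ffun 'I_l -> 'S_n} =>
              average f (xbar f gamma x0 sigma)) - average f xstar <=
      2 * D * Num.sqrt (n%:R * D *
          (enorm (Delta f xstar) + LH * L * D ^+ 2 + 2 * LH * D * G))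
        / Num.sqrt T%:R +
      C0 * (1 + ln T%:R) `^ q *
        ((n%:R / T%:R) `^ (2 / 3) * delta `^ (1 / 3) + (n%:R / T%:R) `^ (3 / 4))].
Proof.
pose K1 := 2 * G * L + 4 * D * L ^+ 2; pose K2 := 36 * D * G + 128 * D ^+ 2 * L.
pose C0 := 16 * L * D ^+ 2 + D ^+ 2 * L + D ^+ 2 * (L ^+ 2 / D) `^ (1 / 3)
    + K1 * ((D / L ^+ 2) `^ (1 / 3)) ^+ 2 + K2.
have L_ge0 := ltW L_gt0; have D_ge0 := ltW D_gt0; have G_ge0 := ltW G_gt0.
have K1_ge0 : 0 <= K1 by rewrite addr_ge0 ?mulr_ge0.
have K2_ge0 : 0 <= K2 by rewrite addr_ge0 ?mulr_ge0.
have C0_gt0 : 0 < C0.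
  have h1 : 0 < L * D ^+ 2 by rewrite !mulr_gt0.
  rewrite /C0 -!addrA ltr_pwDl ?mulr_gt0//.
  by rewrite !addr_ge0 ?mulr_ge0 ?powR_ge0.
(* no logarithm arises, so that any exponent does *)
exists C0, 1; split=> //.
move=> n d l T f x0 xs delta gamma n2 l0 TE cf df smf lipH xsmin dge dle gE bnd gG.
have n0 : (0 < n)%N by exact: ltnW.
have T0 : (0 < T)%N by rewrite TE muln_gt0 l0.
have nR : 0 < n%:R :> R by rewrite ltr0n.
have lR : 0 < l%:R :> R by rewrite ltr0n.
have log1 : 1 <= (1 + ln T%:R) `^ (1 : R).
  have : 0 <= ln T%:R :> R by rewrite ln_ge0// ler1n.
  by move=> lnT; rewrite powRr1 ?addr_ge0// lerDl.
have rem_ge0 : 0 <= (n%:R / T%:R) `^ (2 / 3) * delta `^ (1 / 3)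
    + (n%:R / T%:R) `^ (3 / 4) :> R.
  by rewrite addr_ge0 ?mulr_ge0 ?powR_ge0.
have [LH0|LH0] := ltP LH 0.
  rewrite (_ : (fun _ => _) = fun=> average f xs); last first.
    apply/funext => sigma; congr (average f _).
    exact: lipschitz_hess_lt0 LH0 (lipH (Ordinal n0)) _ _.
  rewrite expect_cst subrr addr_ge0//.
    by rewrite divr_ge0 ?mulr_ge0 ?sqrtr_ge0.
  by rewrite !mulr_ge0// ?powR_ge0// ltW.
have de0 : 0 <= delta.
  exact: le_trans (enorm_ge0 _) (dge (Ordinal n0) xs).
set B := enorm _ + _ + _ in gE *.
have B0 : 0 <= B by rewrite !addr_ge0 ?enorm_ge0 ?mulr_ge0.
have [g0 [c1 c2 c3 c4] cases] := step_size_spec n0 T0 L_gt0 D_gt0 de0 B0.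
rewrite -gE in g0 c1 c2 c3 c4 cases.
pose z := gamma * n%:R; have z0 : 0 < z by rewrite mulr_gt0.
(* in terms of the total step z of an epoch and of the number l of epochs *)
have TR : T%:R = l%:R * n%:R :> R by rewrite TE natrM.
have E1 : gamma * (16 * n%:R * L) = 16 * (z * L) by rewrite /z; ring.
have E2 : gamma ^+ 2 * (T%:R * n%:R * B) = z ^+ 2 * (l%:R * B).
  by rewrite /z TR; ring.
have E3 : gamma ^+ 3 * (T%:R * n%:R ^+ 2 * L ^+ 2 * delta) =
    z ^+ 3 * (l%:R * L ^+ 2 * delta) by rewrite /z TR; ring.
have E4 : gamma ^+ 4 * (T%:R * n%:R ^+ 3 * L ^+ 4) = z ^+ 4 * (l%:R * L ^+ 4).
  by rewrite /z TR; ring.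
rewrite {}E1 in c1 cases; rewrite {}E2 in c2 cases.
rewrite {}E3 in c3 cases; rewrite {}E4 in c4 cases.
have eta1 : 2 * G * LH * z ^+ 2 <= l%:R^-1.
  rewrite -div1r ler_pdivlMr// -(ler_pM2r D_gt0) mul1r; apply: le_trans c2.
  rewrite (_ : 2 * G * LH * z ^+ 2 * l%:R * D = z ^+ 2 * (l%:R * (2 * LH * D * G)));
    last by ring.
  rewrite !ler_pM2l ?exprn_gt0// lerDr.
  by rewrite addr_ge0 ?enorm_ge0 ?mulr_ge0.
have eta2 : z ^+ 4 * L ^+ 4 <= l%:R^-1.
  by rewrite -div1r ler_pdivlMr// -mulrA (mulrC (L ^+ 4)).
have bnd0 (sigma : {ffun 'I_l -> 'S_n}) (t : 'I_l) :
    enorm (boundary f gamma sigma x0 t - xs) <= D.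
  by rewrite -iterate0 bnd.
apply: le_trans (expected_gap_xbar n0 l0 L_gt0 LH0 D_ge0 G_ge0 g0 cf df smf lipH
  xsmin dge dle bnd0 gG c1 eta1 eta2) _.
have l1 : 1 <= l%:R :> R by rewrite ler1n.
apply: le_trans (rate_bound L_gt0 D_gt0 B0 de0 z0 l1 K1_ge0 K2_ge0 c2 c3 cases) _.
have nT : n%:R / T%:R = l%:R^-1 :> R.
  by rewrite TR; field; rewrite !gt_eqF.
have -> : 2 * D * Num.sqrt (n%:R * D * B) / Num.sqrt T%:R =
    2 * D * Num.sqrt (D * B / l%:R).
  rewrite -mulrA -sqrtrV// -sqrtrM ?mulr_ge0//; congr (_ * Num.sqrt _).
  by rewrite TR; field; rewrite !gt_eqF.
rewrite nT -/C0 lerD2l in rem_ge0 *.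
by rewrite ler_wpM2r// ler_peMr// ltW.
Qed.
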